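(* Let $Z=\alpha_1\times\dots\times\alpha_n\times k_1\times\dots\times k_m$ with $n>0$, $m\ge0$, ordinals $\alpha_1,\dots,\alpha_n\ge\omega$ and integers $0<k_1,\dots,k_m<\omega$. Then $\mathbf{w}(Z)=\mathbf{o}(Z)$ if and only if both: (i) there exists $i\in[1,n]$ such that $\alpha_i$ is an infinite indecomposable ordinal (i.e. $\alpha_i=\omega^{\beta}$ for some $\beta\ge1$); and (ii) there exist $j_1\ne j_2\in[1,n]$ such that all exponents in the Cantor normal forms of $\alpha_{j_1}$ and $\alpha_{j_2}$ are infinite (equivalently, $\alpha_{j_1}$ and $\alpha_{j_2}$ are of the form $\omega^\omega\cdot\gamma$). ($i$ may equal $j_1$ or $j_2$.)
   Context: Finite $k_j$ denotes the chain $\{0<\dots<k_j-1\}$; products have the componentwise order. For a wqo $A$, $\mathbf{w}(A)$ (width) is the rank of the forest of nonempty finite sequences of pairwise incomparable elements ordered by initial segment, and $\mathbf{o}(A)$ (maximal order type) is the rank of the forest of nonempty finite bad sequences ordered by initial segment (a sequence $x_0,x_1,\dots$ is bad if there are no $i<j$ with $x_i\le x_j$); equivalently $\mathbf{o}(A)$ is the maximal order type of a linear extension of $A$. Ranks: $r(s)=\sup\{r(t)+1:t$ child of $s\}$, invariant $=\sup_s(r(s)+1)$. *)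

(* Defs.v *)
From mathcomp Require Import all_boot.
From Stdlib Require List.
Set Implicit Arguments. Unset Strict Implicit. Unset Printing Implicit Defensive.

(* Ordinals used as values of ranks: Brouwer trees.                        *)
(* [OSup f] denotes  sup_i (f i + 1)  (least ordinal > every f i).         *)
Inductive Ord : Type := OSup : forall I1 : Type, (I1 -> Ord) -> Ord.

(* |OSup f| <= |OSup g|  iff  every f i < |OSup g|  iff  forall i, exists j, f i <= g j *)
Fixpoint ole (a b : Ord) {struct a} : Prop :=
  match a, b with @OSup I1 f, @OSup J1 g => forall i : I1, exists j : J1, ole (f i) (g j) end.

Definition oeq (a b : Ord) : Prop := ole a b /\ ole b a.

(* Rank of a forest of nonempty finite sequences (ordered by initial       *)
(* segment) satisfying a prefix-closed property P.  The children of s are  *)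
(* the one-element extensions  rcons s x  satisfying P.                     *)
Section Forest.
Variables (X : Type) (P : list X -> Prop).

Definition fchild (t s : list X) : Prop := P t /\ exists x, t = rcons s x.

Fixpoint acc_rank (s : list X) (h : Acc fchild s) {struct h} : Ord :=
  match h with
  | Acc_intro hf =>
      @OSup {t | fchild t s} (fun p => acc_rank (hf (proj1_sig p) (proj2_sig p)))
  end.

(* invariant = sup_s (r(s) + 1), over the nodes (nonempty sequences with P);
   for the well-founded forests considered (wqos) every node is accessible. *)
Definition forest_inv : Ord :=
  @OSup {s : list X | (P s /\ s <> nil) /\ Acc fchild s}
        (fun p => acc_rank (proj2 (proj2_sig p))).
End Forest.

Fixpoint lall (X : Type) (p : X -> Prop) (l : list X) : Prop :=
  match l with nil => True | y :: t => p y /\ lall p t end.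

Fixpoint bad (X : Type) (le : X -> X -> Prop) (l : list X) : Prop :=
  match l with
  | nil => True
  | x :: t => lall (fun y => ~ le x y) t /\ bad le t
  end.

Fixpoint antichain (X : Type) (le : X -> X -> Prop) (l : list X) : Prop :=
  match l with
  | nil => True
  | x :: t => lall (fun y => ~ le x y /\ ~ le y x) t /\ antichain le t
  end.

Definition width (X : Type) (le : X -> X -> Prop) : Ord := forest_inv (antichain le).
Definition mot (X : Type) (le : X -> X -> Prop) : Ord := forest_inv (bad le).

(* Ordinals as (strict) well-ordered types: alpha is the chain {beta < alpha}. *)
Record woset := WOSet {
  wo_car :> Type;
  wo_lt : wo_car -> wo_car -> Prop;
  wo_irr : forall x, ~ wo_lt x x;
  wo_trans : forall x y z, wo_lt x y -> wo_lt y z -> wo_lt x z;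
  wo_total : forall x y, wo_lt x y \/ x = y \/ wo_lt y x;
  wo_wf : well_founded wo_lt
}.

Definition wo_le (W : woset) (a b : W) : Prop := wo_lt a b \/ a = b.

Definition Zcar (n m : nat) (A : 'I_n -> woset) (k : 'I_m -> nat) : Type :=
  ((forall i : 'I_n, wo_car (A i)) * (forall j : 'I_m, 'I_(k j)))%type.

Definition Zle (n m : nat) (A : 'I_n -> woset) (k : 'I_m -> nat)
    (x y : Zcar A k) : Prop :=
  (forall i : 'I_n, wo_le (x.1 i) (y.1 i)) /\
  (forall j : 'I_m, (nat_of_ord (x.2 j) <= nat_of_ord (y.2 j))%N).

Definition order_iso (T U : Type) (ltT : T -> T -> Prop) (ltU : U -> U -> Prop) : Prop :=
  exists (f : T -> U) (g : U -> T),
    cancel f g /\ cancel g f /\ forall x y, ltT x y <-> ltU (f x) (f y).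

Definition omega_le (W : woset) : Prop :=
  exists f : nat -> W, forall a b : nat, (a < b)%N -> wo_lt (f a) (f b).

(* omega^beta: finitely supported functions beta -> omega, compared at the
   largest point where they differ (the standard construction). *)
Definition fin_supp (B : Type) (f : B -> nat) : Prop :=
  exists l : list B, forall x, f x <> 0 -> List.In x l.

Definition omega_pow_car (B : Type) : Type := {f : B -> nat | fin_supp f}.

Definition omega_pow_lt (B : Type) (ltB : B -> B -> Prop)
    (f g : omega_pow_car B) : Prop :=
  exists x, (proj1_sig f x < proj1_sig g x)%N /\
            forall y, ltB x y -> proj1_sig f y = proj1_sig g y.

Definition nat_lt (a b : nat) : Prop := (a < b)%N.

(* delta * gamma = gamma copies of delta: pairs (g, d), g most significant *)
Definition lexprod_lt (G D : Type) (ltG : G -> G -> Prop) (ltD : D -> D -> Prop)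
    (u v : G * D) : Prop :=
  ltG u.1 v.1 \/ (u.1 = v.1 /\ ltD u.2 v.2).

Definition inf_indecomposable (W : woset) : Prop :=
  exists B : woset, inhabited B /\
    order_iso (@wo_lt W) (@omega_pow_lt B (@wo_lt B)).

(* all exponents of the Cantor normal form of alpha are infinite:
   alpha = omega^omega * gamma for some ordinal gamma (>= 1) *)
Definition cnf_exponents_infinite (W : woset) : Prop :=
  exists G : woset, inhabited G /\
    order_iso (@wo_lt W)
      (@lexprod_lt G (omega_pow_car nat) (@wo_lt G) (@omega_pow_lt nat nat_lt)).

(* Main.v *)
Require Import Defs.
From HB Require Import structures.
From mathcomp Require Import all_boot.
From Stdlib Require Import Inverse_Image Inclusion Classical ClassicalEpsilon FunctionalExtensionality PropExtensionality ProofIrrelevance.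

(** The invariant of a subset [S] of a product of well-orders is [rk v S], the rank of
its forest of bad ([v = false]) or antichain ([v = true]) sequences; it is subadditive
for the natural sum.  Cantor normal forms cut [Z] into finitely many blocks, each a
product of powers of omega, of additively closed maximal order type.

Lower bounds: use the blocks from the top downwards.  A bad sequence may always move
on to a lower block; an antichain may do so if some coordinate ranges over an infinite
indecomposable ordinal, along which it can climb above all earlier elements.  So o(Z)
is the natural sum of the o(block), and under (i) w(Z) is at least the natural sum of
the w(block).  The same argument inside a block gives
w(omega^(1+a1) x omega^(1+a2) x omega^a3 x ...) >= o(omega^a1 x omega^a2 x ...),
which under (ii) is w(block) >= o(block), since 1 + a = a for infinite a.

Upper bounds: without (i) the lowest block lies entirely below the highest one, so an
antichain misses one of them.  Without (ii) the last block has at most one infinite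
exponent, and its width is smaller than its maximal order type by a factor omega. *)

Set Implicit Arguments. Unset Strict Implicit. Unset Printing Implicit Defensive.

(** No rank of a block is computed exactly. What is used is that o(block) is additively closed and
    that everything below it is bounded by finitely many blocks with one exponent lowered; the
    inductions run along this lowering. The exponents 1 + a arise because, inside a block, an
    antichain must climb along a coordinate other than the one being lowered: with two nonzero
    exponents one is always left, and the shift keeps both nonzero throughout the induction. Each
    factor is embedded as an initial segment of a power of omega made of finitely supported
    functions, whose pointwise (natural) sum is strictly monotone in each argument. Translations
    therefore reflect the order, and they move copies of a block above earlier elements. When (ii)
    fails, the last block is decisive because it carries the least exponent of each factor. *)

Definition asb (P : Prop) : bool := if excluded_middle_informative P then true else false.

Lemma asbP (P : Prop) : reflect P (asb P).
Proof. by rewrite /asb; case: excluded_middle_informative => h; constructor. Qed.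

Lemma sig_eq (T : Type) (P : T -> Prop) (x y : sig P) : proj1_sig x = proj1_sig y -> x = y.
Proof.
case: x y => [x hx] [y hy] /= e; subst y.
by rewrite (proof_irrelevance _ hx hy).
Qed.

(** * Ordinals *)

Definition olt (a b : Ord) : Prop :=
  match b with OSup J g => exists j : J, ole a (g j) end.

Lemma ole_refl a : ole a a.
Proof. by elim: a => I f IH /= i; exists i. Qed.

Lemma ole_trans b a c : ole a b -> ole b c -> ole a c.
Proof.
elim: a b c => I f IH [J g] [K h] /= ab bc i.
have [j fg] := ab i; have [k gh] := bc j.
by exists k; apply: IH fg gh.
Qed.

Lemma ole_or_olt a b : ole a b \/ olt b a.
Proof.
elim: a b => I f IH [J g] /=.
case: (classic (forall i, exists j, ole (f i) (g j))) => [|/not_all_ex_not [i hi]]; first by left.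
right; exists i.
have gf j : olt (g j) (f i) by case: (IH i (g j)) => // h; case: hi; exists j.
by move: gf; case: (f i) => K h.
Qed.

Lemma olt_ole_trans b a c : olt a b -> ole b c -> olt a c.
Proof.
case: b c => [J g] [K h] /= [j aj] gh; have [k jk] := gh j.
by exists k; apply: ole_trans jk.
Qed.

Lemma ole_olt_trans b a c : ole a b -> olt b c -> olt a c.
Proof. by case: c => K h /= ab [k bk]; exists k; apply: ole_trans bk. Qed.

Lemma olt_OSup (I : Type) (f : I -> Ord) i : olt (f i) (OSup f).
Proof. by exists i; apply: ole_refl. Qed.

Lemma olt_irr a : ~ olt a a.
Proof.
elim: a => I f IH [i /= h]; apply: (IH i).
exact: olt_ole_trans (olt_OSup f i) h.
Qed.

Lemma olt_ole a b : olt a b -> ole a b.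
Proof.
elim: a b => I f IH [J g] /= [j h] i; exists j.
exact: IH (olt_ole_trans (b := OSup f) (olt_OSup f i) h).
Qed.

Lemma olt_wf : well_founded olt.
Proof.
move=> a; suff: forall b, ole b a -> Acc olt b by apply; apply: ole_refl.
elim: a => I f IH b ba; constructor=> c cb.
have [i ci] : olt c (OSup f) by apply: olt_ole_trans ba.
exact: IH ci.
Qed.

(** Natural (Hessenberg) sum by its game recursion: one step decreases one of the two summands. The
    inner fixpoint keeps the recursion structural in each argument. *)
Fixpoint hsum (a : Ord) : Ord -> Ord :=
  match a with @OSup K f =>
    fix hs (b : Ord) : Ord :=
      match b with @OSup J g =>
        OSup (fun k : K + J =>
          match k with inl i => hsum (f i) b | inr j => hs (g j) end)
      end
  end.

Lemma hsum_mono a a' b b' : ole a a' -> ole b b' -> ole (hsum a b) (hsum a' b').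
Proof.
elim: a a' b b' => I f IHa [I' f'] b b' aa.
elim: b b' => J g IHb [J' g'] bb [i|j].
  by have [i' h] := aa i; exists (inl i'); apply: IHa.
by have [j' h] := bb j; exists (inr j'); apply: IHb.
Qed.

(* Brouwer trees are only preordered by [ole]; choosing a representative of each
   [oeq] class gives a type of ordinals with Leibniz equality. *)
Definition canon (a : Ord) : Ord := epsilon (inhabits a) (fun b => oeq a b).

Lemma canonP a : oeq a (canon a).
Proof. by apply: epsilon_spec; exists a; split; apply: ole_refl. Qed.

Lemma eq_canon a b : oeq a b -> canon a = canon b.
Proof.
move=> [ab ba]; have e : oeq a = oeq b.
  apply: functional_extensionality => c; apply: propositional_extensionality.
  split=> -[h1 h2]; split;
    [exact: ole_trans ba h1 | exact: ole_trans h2 ab | exact: ole_trans ab h1 | exact: ole_trans h2 ba].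
rewrite /canon e; congr (epsilon _ _); exact: proof_irrelevance.
Qed.

Definition On : Type := {a : Ord | canon a = a}.

Lemma canonK a : canon (canon a) = canon a.
Proof. by case: (canonP a) => h1 h2; apply: eq_canon. Qed.

Definition cls (a : Ord) : On := exist _ (canon a) (canonK a).
Definition rep (x : On) : Ord := proj1_sig x.
Definition leO (x y : On) : Prop := ole (rep x) (rep y).
Definition ltO (x y : On) : Prop := olt (rep x) (rep y).
Notation "x <=o y" := (leO x y) (at level 70, no associativity).
Notation "x <o y" := (ltO x y) (at level 70, no associativity).

Lemma repK x : cls (rep x) = x.
Proof. by apply: sig_eq; apply: (proj2_sig x). Qed.

Lemma cls_le a b : cls a <=o cls b <-> ole a b.
Proof.
have [a1 a2] := canonP a; have [b1 b2] := canonP b.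
by split=> h; [apply: ole_trans a1 (ole_trans h b2) | apply: ole_trans a2 (ole_trans h b1)].
Qed.

Lemma cls_lt a b : cls a <o cls b <-> olt a b.
Proof.
have [a1 a2] := canonP a; have [b1 b2] := canonP b.
split=> h.
  by apply: ole_olt_trans a1 _; apply: olt_ole_trans b2.
by apply: ole_olt_trans a2 _; apply: olt_ole_trans b1.
Qed.

Lemma cls_eq a b : cls a = cls b <-> oeq a b.
Proof.
split=> [h | h]; last by apply: sig_eq; apply: eq_canon.
by split; apply/cls_le; rewrite h; apply: ole_refl.
Qed.

Lemma leO_refl x : x <=o x. Proof. exact: ole_refl. Qed.
Hint Resolve leO_refl : core.

Lemma leO_trans y x z : x <=o y -> y <=o z -> x <=o z.
Proof. exact: ole_trans. Qed.

Lemma leO_anti x y : x <=o y -> y <=o x -> x = y.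
Proof. by move=> h1 h2; rewrite -(repK x) -(repK y); apply/cls_eq. Qed.

Lemma leO_or_ltO x y : x <=o y \/ y <o x.
Proof. exact: ole_or_olt. Qed.

Lemma leO_ltO_trans y x z : x <=o y -> y <o z -> x <o z.
Proof. exact: ole_olt_trans. Qed.

Lemma ltO_leO_trans y x z : x <o y -> y <=o z -> x <o z.
Proof. exact: olt_ole_trans. Qed.

Lemma ltO_leO x y : x <o y -> x <=o y.
Proof. exact: olt_ole. Qed.

Lemma ltO_trans y x z : x <o y -> y <o z -> x <o z.
Proof. by move=> h /ltO_leO; apply: ltO_leO_trans. Qed.

Lemma ltO_irr x : ~ x <o x.
Proof. exact: olt_irr. Qed.

Lemma ltO_nge x y : x <o y <-> ~ y <=o x.
Proof.
split=> [xy yx|h]; first exact: ltO_irr (ltO_leO_trans xy yx).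
by case: (leO_or_ltO y x).
Qed.

Lemma ltO_wf : well_founded ltO.
Proof. exact: (wf_inverse_image _ _ olt rep olt_wf). Qed.

Lemma leO_from_lt x y : (forall z, z <o x -> z <o y) -> x <=o y.
Proof. by move=> h; case: (leO_or_ltO x y) => // /h /ltO_irr. Qed.

Definition osup (I : Type) (f : I -> On) : On := cls (OSup (fun i => rep (f i))).

Lemma osup_le (I : Type) (f : I -> On) x : osup f <=o x <-> forall i, f i <o x.
Proof.
split=> [h i|h].
  by apply: ltO_leO_trans h; rewrite -(repK (f i)); apply/cls_lt; apply: (olt_OSup (fun i => rep (f i))).
rewrite -(repK x); apply/cls_le; case E: (rep x) => [J g] i.
by move: (h i); rewrite /ltO E.
Qed.

Lemma lt_osup (I : Type) (f : I -> On) i : f i <o osup f.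
Proof. by move: i; apply/osup_le. Qed.

Lemma osup_gt (I : Type) (f : I -> On) x : x <o osup f -> exists i, x <=o f i.
Proof.
move=> h; apply: NNPP => /not_ex_all_not hn.
apply: (@ltO_irr x); apply: ltO_leO_trans h _; apply/osup_le => i.
by apply/ltO_nge/hn.
Qed.

Definition zeroO : On := osup (fun x : Empty_set => match x with end).

Lemma le0O x : zeroO <=o x.
Proof. by apply/osup_le; case. Qed.
Hint Resolve le0O : core.

Definition oneO : On := osup (fun _ : unit => zeroO).

Lemma le1O x : oneO <=o x <-> zeroO <o x.
Proof. by split=> [/osup_le/(_ tt)|h] //; apply/osup_le. Qed.

Definition hadd (x y : On) : On := cls (hsum (rep x) (rep y)).

Lemma hadd_mono x x' y y' : x <=o x' -> y <=o y' -> hadd x y <=o hadd x' y'.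
Proof. by move=> h1 h2; apply/cls_le/hsum_mono. Qed.

Lemma hadd_lt_l x x' y : x <o x' -> hadd x y <o hadd x' y.
Proof.
move=> h; apply/cls_lt; move: h; rewrite /ltO.
case: (rep x') => I f [i xi]; case: (rep y) => J g.
by apply: ole_olt_trans (olt_OSup _ (inl i)); apply: hsum_mono => //; apply: ole_refl.
Qed.

Lemma hadd_lt_r x y y' : y <o y' -> hadd x y <o hadd x y'.
Proof.
move=> h; apply/cls_lt; move: h; rewrite /ltO.
case: (rep y') => J g [j yj]; case: (rep x) => I f.
by apply: ole_olt_trans (olt_OSup _ (inr j)); exact: (hsum_mono (ole_refl (OSup f)) yj).
Qed.

Lemma lt_hadd c x y : c <o hadd x y ->
  (exists2 x', x' <o x & c <=o hadd x' y) \/ (exists2 y', y' <o y & c <=o hadd x y').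
Proof.
rewrite -{1}(repK c) => /cls_lt h.
case Ex: (rep x) h => [I f]; case Ey: (rep y) => [J g] /= [[i|j] h].
  left; exists (cls (f i)); first by rewrite -(repK x) Ex; apply/cls_lt/(olt_OSup f).
  rewrite -(repK c); apply/cls_le; apply: ole_trans h _.
  by rewrite Ey; apply: hsum_mono; [case: (canonP (f i)) | apply: ole_refl].
right; exists (cls (g j)); first by rewrite -(repK y) Ey; apply/cls_lt/(olt_OSup g).
rewrite -(repK c); apply/cls_le; apply: ole_trans h _.
by rewrite Ex; exact: (hsum_mono (ole_refl (OSup f)) (proj1 (canonP (g j)))).
Qed.

Lemma hadd_le x y z : (forall x', x' <o x -> hadd x' y <o z) ->
  (forall y', y' <o y -> hadd x y' <o z) -> hadd x y <=o z.
Proof.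
move=> h1 h2; apply: leO_from_lt => c /lt_hadd [] [w hw hc].
  exact: leO_ltO_trans hc (h1 _ hw).
exact: leO_ltO_trans hc (h2 _ hw).
Qed.

Lemma haddC_le x y : hadd x y <=o hadd y x.
Proof.
elim/(well_founded_ind ltO_wf): x y => x IHx y.
elim/(well_founded_ind ltO_wf): y => y IHy.
apply: hadd_le => [x' h|y' h].
  by apply: leO_ltO_trans (IHx _ h _) (hadd_lt_r _ h).
by apply: leO_ltO_trans (IHy _ h) (hadd_lt_l _ h).
Qed.

Lemma haddC : commutative hadd.
Proof. by move=> x y; apply: leO_anti; apply: haddC_le. Qed.

Lemma haddA_le x y z : hadd x (hadd y z) <=o hadd (hadd x y) z.
Proof.
elim/(well_founded_ind ltO_wf): x y z => x IHx y.
elim/(well_founded_ind ltO_wf): y => y IHy z.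
elim/(well_founded_ind ltO_wf): z => z IHz.
apply: hadd_le => [x' h|w /lt_hadd [] [u hu hw]].
- by apply: leO_ltO_trans (IHx _ h _ _) _; do 2 apply: hadd_lt_l.
- apply: leO_ltO_trans (hadd_mono (leO_refl x) hw) _.
  by apply: leO_ltO_trans (IHy _ hu _) _; apply/hadd_lt_l/hadd_lt_r.
- apply: leO_ltO_trans (hadd_mono (leO_refl x) hw) _.
  by apply: leO_ltO_trans (IHz _ hu) _; apply: hadd_lt_r.
Qed.

Lemma haddA : associative hadd.
Proof.
move=> x y z; apply: leO_anti; first exact: haddA_le.
by rewrite (haddC (hadd x y)) (haddC x y) (haddC x) (haddC y z); apply: haddA_le.
Qed.

Lemma add0O : left_id zeroO hadd.
Proof.
move=> x; apply: leO_anti; elim/(well_founded_ind ltO_wf): x => x IH.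
  apply: hadd_le => [y /ltO_nge [] // |y h].
  exact: leO_ltO_trans (IH _ h) h.
by apply: leO_from_lt => z h; apply: leO_ltO_trans (IH _ h) (hadd_lt_r _ h).
Qed.

HB.instance Definition _ := Monoid.isComLaw.Build On zeroO hadd haddA haddC add0O.

Lemma addO0 : right_id zeroO hadd.
Proof. by move=> x; rewrite haddC add0O. Qed.

Lemma le_haddl x y : x <=o hadd x y.
Proof. by rewrite -{1}(addO0 x); apply: hadd_mono. Qed.

(** * Finite natural sums *)

Notation "\osum_ ( i | P ) F" := (\big[hadd/zeroO]_(i | P%B) F)
  (at level 41, F at level 41, i at level 50, format "\osum_ ( i  |  P )  F").
Notation "\osum_ ( i : t ) F" := (\big[hadd/zeroO]_(i : t) F)
  (at level 41, F at level 41, i at level 50, format "\osum_ ( i  :  t )  F").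
Notation "\osum_ ( i <- r ) F" := (\big[hadd/zeroO]_(i <- r) F)
  (at level 41, F at level 41, i at level 50, format "\osum_ ( i  <-  r )  F").

Lemma osum_mono (I : Type) (r : seq I) (P : pred I) (F G : I -> On) :
  (forall i, P i -> F i <=o G i) ->
  \big[hadd/zeroO]_(i <- r | P i) F i <=o \big[hadd/zeroO]_(i <- r | P i) G i.
Proof. by move=> h; elim/big_ind2: _ => // *; apply: hadd_mono. Qed.

Lemma osum_lt (I : finType) (i0 : I) (F G : I -> On) :
  (forall i, F i <=o G i) -> F i0 <o G i0 -> \osum_(i : I) F i <o \osum_(i : I) G i.
Proof.
move=> h h0; rewrite (bigD1 i0) //= [X in _ <o X](bigD1 i0) //=.
by apply: ltO_leO_trans (hadd_lt_l _ h0) _; apply: hadd_mono => //; apply: osum_mono.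
Qed.

Lemma osum_drop_lt (I : finType) (i0 : I) (F : I -> On) :
  zeroO <o F i0 -> \osum_(i | i != i0) F i <o \osum_(i : I) F i.
Proof.
by move=> h0; rewrite [X in _ <o X](bigD1 i0) //= -{1}(add0O (\big[_/_]_(_ | _) _)); apply: hadd_lt_l.
Qed.

Lemma lt_osum (I : finType) (D : {set I}) (F : I -> On) c :
  c <o \osum_(i | i \in D) F i ->
  exists i r, [/\ i \in D, r <o F i & c <=o hadd (\osum_(j | j \in D :\ i) F j) r].
Proof.
move E: #|D| => N; elim: N D c E => [|N IH] D c hN.
  by rewrite (cards0_eq hN) big_pred0 => [|i]; [move/ltO_nge | rewrite inE].
have [i iD] : exists i, i \in D by apply/set0Pn; rewrite -card_gt0 hN.
rewrite (big_setD1 i) //= => /lt_hadd [] [w hw hc].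
  by exists i, w; split=> //; rewrite haddC.
have [|j [r [jD hr hwr]]] := IH (D :\ i) w _ hw.
  by move: hN; rewrite (cardsD1 i) iD => -[].
exists j, r; split=> //; first by case/setD1P: jD.
apply: leO_trans hc _; apply: leO_trans (hadd_mono (leO_refl _) hwr) _.
rewrite haddA (big_setD1 i (A := D :\ j)) /=; last first.
  by rewrite in_setD1 iD andbT eq_sym; case/setD1P: jD.
by rewrite !setDDl setUC.
Qed.

(** * Additively closed ordinals and their finite multiples *)

(** These are 0 and the powers of omega, characterised without ordinal exponentiation. *)
Definition closedO (t : On) : Prop := forall a b, a <o t -> b <o t -> hadd a b <o t.

Definition mulO (t : On) (C : nat) : On := iter C (hadd t) zeroO.

Lemma mulO_osum t C : \osum_(i : 'I_C) t = mulO t C.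
Proof. by rewrite big_const_ord. Qed.

Lemma mulO_add t m n : mulO t (m + n) = hadd (mulO t m) (mulO t n).
Proof.
elim: m => [|m IH]; first by rewrite add0O.
by rewrite addSn -[mulO t (m + n).+1]/(hadd t (mulO t (m + n))) IH haddA.
Qed.

Lemma mulO_mono t u C : t <=o u -> mulO t C <=o mulO u C.
Proof. by move=> h; elim: C => //= C IH; apply: hadd_mono. Qed.

Lemma closedO_osum t (I : Type) (r : seq I) (P : pred I) F : closedO t -> zeroO <o t ->
  (forall i, P i -> F i <o t) -> \big[hadd/zeroO]_(i <- r | P i) F i <o t.
Proof. by move=> ct t0 h; elim/big_ind: _ => //; apply: ct. Qed.

Lemma closedO_mulO t u C : closedO t -> u <o t -> mulO u C <o t.
Proof.
move=> ct h; rewrite -mulO_osum; apply: closedO_osum => //.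
exact: leO_ltO_trans (le0O u) h.
Qed.

(** For positive [t] this is t * omega, the least ordinal above all finite multiples. *)
Definition omegaO (t : On) : On := osup (fun C => mulO t C).

Lemma omegaO_closed t : closedO (omegaO t).
Proof.
move=> a b /osup_gt [m am] /osup_gt [n bn].
apply: leO_ltO_trans (hadd_mono am bn) _.
by rewrite -mulO_add; apply: lt_osup.
Qed.

Lemma lt_omegaO t : t <o omegaO t.
Proof. by rewrite -{1}(addO0 t); apply: (lt_osup (fun C => mulO t C) 1). Qed.

Lemma wf_rank (T : Type) (R : T -> T -> Prop) : well_founded R ->
  exists r : T -> On, forall x y, R x y -> r x <o r y.
Proof.
move=> wfR.
pose r := Fix wfR (fun _ => On)
  (fun x rec => osup (fun y : {y | R y x} => rec (proj1_sig y) (proj2_sig y))).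
exists r => x y xy; rewrite {2}/r Fix_eq.
  exact: (lt_osup (fun z : {z | R z y} => r (proj1_sig z)) (exist _ x xy)).
move=> z f g fg; congr osup; apply: functional_extensionality => w; exact: fg.
Qed.

(** * Ranks of sets under bad and antichain sequences *)

(* [follows le v x y]: [y] may occur after [x] in a bad sequence ([v = false]),
   resp. in an antichain sequence ([v = true]). *)
Definition follows (X : Type) (le : X -> X -> Prop) (v : bool) (x y : X) : Prop :=
  ~ le x y /\ (v -> ~ le y x).

Definition residual (X : Type) (le : X -> X -> Prop) v (S : X -> Prop) (z : X) : X -> Prop :=
  fun x => S x /\ follows le v z x.

(** The continuations of a sequence depend only on the set of elements that may still follow, so
    ranks can be computed on sets shrinking along [rstep]. *)
Definition rstep (X : Type) (le : X -> X -> Prop) v (S' S : X -> Prop) : Prop :=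
  exists2 z, S z & S' = residual le v S z.

Record wqo := Wqo {
  wqo_car :> Type;
  wqo_le : wqo_car -> wqo_car -> Prop;
  wqo_wf : well_founded (rstep wqo_le false)
}.

Lemma Acc_rstep_map (X Y : Type) (leX : X -> X -> Prop) (leY : Y -> Y -> Prop) v
    (h : X -> Y) (S' : Y -> Prop) :
  Acc (rstep leY false) S' -> (forall x y, leY (h x) (h y) -> leX x y) ->
  forall S : X -> Prop, (forall x, S x -> S' (h x)) -> Acc (rstep leX v) S.
Proof.
move=> acc hle; elim: acc => {}S' _ IH S SS'; constructor=> _ [z Sz ->].
apply: (IH (residual leY false S' (h z))); first by exists (h z); first exact: SS'.
by move=> x [Sx [zx _]]; split; [apply: SS' | split=> // /hle].
Qed.

Lemma Acc_rstep_sub (X : Type) (le : X -> X -> Prop) v (S' S : X -> Prop) :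
  Acc (rstep le false) S' -> (forall x, S x -> S' x) -> Acc (rstep le v) S.
Proof. by move=> acc; apply: (@Acc_rstep_map X X le le v id S' acc). Qed.

Arguments Acc_rstep_sub {X le v S' S}.

Lemma Acc_rstep_union (X : Type) (le : X -> X -> Prop) (S1 S2 S : X -> Prop) :
  Acc (rstep le false) S1 -> Acc (rstep le false) S2 ->
  (forall x, S x -> S1 x \/ S2 x) -> Acc (rstep le false) S.
Proof.
move=> acc1; elim: acc1 S2 S => {}S1 _ IH1 S2 S acc2.
elim: acc2 S => {}S2 acc2 IH2 S hS.
have acc2' : Acc (rstep le false) S2 by constructor.
constructor=> _ [z Sz ->]; case: (hS z Sz) => Sz'.
  apply: (IH1 (residual le false S1 z)) acc2' _; first by exists z.
  by move=> x [/hS [] hx f]; [left | right].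
apply: (IH2 (residual le false S2 z)); first by exists z.
by move=> x [/hS [] hx f]; [left | right].
Qed.

Section Rank.
Variables (X : wqo) (v : bool).
Local Notation res := (residual (@wqo_le X) v).

Lemma rstep_wf : well_founded (rstep (@wqo_le X) v).
Proof.
by move=> S; apply: Acc_rstep_sub (wqo_wf S) _.
Qed.

Definition rk : (X -> Prop) -> On := Fix rstep_wf (fun _ => On)
  (fun S rec => osup (fun z : {z | S z} =>
     rec (res S (proj1_sig z)) (ex_intro2 _ _ _ (proj2_sig z) erefl))).

Lemma rkE S : rk S = osup (fun z : {z | S z} => rk (res S (proj1_sig z))).
Proof.
rewrite {1}/rk Fix_eq // => T f g fg.
by congr osup; apply: functional_extensionality => z.
Qed.

Lemma rk_le S a : rk S <=o a <-> forall z, S z -> rk (res S z) <o a.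
Proof.
rewrite rkE osup_le; split=> [h z Sz|h [z Sz]]; last exact: h.
exact: (h (exist _ z Sz)).
Qed.

Lemma rk_res_lt S z : S z -> rk (res S z) <o rk S.
Proof. by move: z; apply/rk_le. Qed.

Lemma lt_rk S a : a <o rk S -> exists2 z, S z & a <=o rk (res S z).
Proof. by rewrite rkE => /osup_gt [[z Sz] h]; exists z. Qed.

Lemma le_rk S a : (forall c, c <o a -> exists2 z, S z & c <=o rk (res S z)) -> a <=o rk S.
Proof.
move=> h; apply: leO_from_lt => c /h [z Sz hc].
exact: leO_ltO_trans hc (rk_res_lt Sz).
Qed.

Lemma rk_gt0 S z : S z -> zeroO <o rk S.
Proof. by move=> Sz; apply: leO_ltO_trans (rk_res_lt Sz). Qed.

Lemma rk_empty S : (forall x, ~ S x) -> rk S = zeroO.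
Proof. by move=> h; apply: leO_anti => //; apply/rk_le => z /h. Qed.
End Rank.

Arguments rk {X} v S.

Lemma rk_map (X Y : wqo) v (S : X -> Prop) (S' : Y -> Prop) (h : X -> Y) :
  (forall x, S x -> S' (h x)) ->
  (forall x y, S x -> S y -> wqo_le (h x) (h y) -> wqo_le x y) ->
  rk v S <=o rk v S'.
Proof.
move: S S'; apply: (well_founded_ind (rstep_wf (X := X) v)) => S IH S' hS hle.
apply/rk_le => z Sz; apply: leO_ltO_trans (rk_res_lt v (hS z Sz)).
apply: IH => [|x [Sx [zx xz]]|x y [Sx _] [Sy _]]; first by exists z.
  split; first exact: hS.
  by split=> [h'|hv h']; [apply: zx | apply: (xz hv)]; apply: hle.
exact: hle.
Qed.

Lemma rk_sub (X : wqo) v (S S' : X -> Prop) : (forall x, S x -> S' x) -> rk v S <=o rk v S'.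
Proof. by move=> h; apply: (@rk_map X X v S S' id). Qed.

Lemma rk_anti_bad (X : wqo) (S : X -> Prop) : rk true S <=o rk false S.
Proof.
(* An antichain residual may be smaller than the bad residual, so the induction has to compare a set
   with any larger one. *)
suff: forall S' : X -> Prop, (forall x, S x -> S' x) -> rk true S <=o rk false S' by apply.
move: S; apply: (well_founded_ind (rstep_wf (X := X) true)) => S IH S' hS.
apply/rk_le => z Sz; apply: leO_ltO_trans (rk_res_lt false (hS z Sz)).
apply: IH; first by exists z.
by move=> x [Sx [zx _]]; split; [apply: hS | split].
Qed.

(** Each chosen element lies in one of the two parts and strictly lowers the rank of that part; the
    natural sum allows for every interleaving. *)
Lemma rk_union (X : wqo) v (S S1 S2 : X -> Prop) :
  (forall x, S x -> S1 x \/ S2 x) -> rk v S <=o hadd (rk v S1) (rk v S2).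
Proof.
move: S S1 S2; apply: (well_founded_ind (rstep_wf (X := X) v)) => S IH S1 S2 hS.
apply/rk_le => z Sz; case: (hS z Sz) => Sz'.
  apply: leO_ltO_trans (hadd_lt_l _ (rk_res_lt v Sz')).
  by apply: IH; [exists z | move=> x [/hS [] hx f]; [left | right]].
apply: leO_ltO_trans (hadd_lt_r _ (rk_res_lt v Sz')).
by apply: IH; [exists z | move=> x [/hS [] hx f]; [left | right]].
Qed.

Lemma rk_bigunion (X : wqo) v (L : finType) (P : pred L) (S : X -> Prop) (F : L -> X -> Prop) :
  (forall x, S x -> exists2 l, P l & F l x) -> rk v S <=o \osum_(l | P l) rk v (F l).
Proof.
move=> hS; rewrite -big_filter.
have {}hS x : S x -> exists2 l, l \in filter P (index_enum L) & F l x.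
  by move=> /hS [l Pl Fl]; exists l; rewrite // mem_filter Pl mem_index_enum.
elim: (filter _ _) S hS => [|l s IH] S hS.
  by rewrite rk_empty // => x /hS [].
rewrite big_cons; set S2 := fun x => S x /\ exists2 l, l \in s & F l x.
apply: leO_trans (rk_union (S1 := F l) (S2 := S2) _ _) _.
  move=> x Sx; have [m] := hS x Sx; rewrite inE => /orP [/eqP -> |ms] Fm; [by left | right].
  by split=> //; exists m.
by apply: hadd_mono => //; apply: IH => x [].
Qed.

(* An antichain cannot meet both [lo] and [hi] when [lo] lies below [hi]. *)
Lemma rk_anti_low_high (X : wqo) (lo hi : X -> Prop) (S : X -> Prop) a :
  (forall x y, lo x -> hi y -> wqo_le x y) -> (forall x, lo x -> ~ hi x) ->
  rk true (fun x => S x /\ ~ lo x) <=o a -> rk true (fun x => S x /\ ~ hi x) <=o a ->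
  rk true S <=o a.
Proof.
move=> lohi disj; move: S a; apply: (well_founded_ind (rstep_wf (X := X) true)) => S IH a hlo hhi.
apply/rk_le => z Sz; case: (classic (lo z)) => [loz|nloz].
  have nhiz := disj z loz.
  apply: ltO_leO_trans hhi; apply: leO_ltO_trans (rk_res_lt (z := z) true _) => //.
  by apply: rk_sub => x [Sx [zx xz]]; split=> //; split=> // hix; apply/zx/lohi.
case: (classic (hi z)) => [hiz|nhiz].
  apply: ltO_leO_trans hlo; apply: leO_ltO_trans (rk_res_lt (z := z) true _) => //.
  by apply: rk_sub => x [Sx [zx xz]]; split=> //; split=> // lox; apply/(xz isT)/lohi.
have lt1 (K : X -> Prop) : ~ K z -> rk true (fun x => S x /\ ~ K x) <=o a ->
    rk true (fun x => residual (@wqo_le X) true S z x /\ ~ K x) <o a.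
  move=> Kz; apply: ltO_leO_trans; apply: leO_ltO_trans (rk_res_lt (z := z) true _) => //.
  by apply: rk_sub => x [[]].
have h1 := lt1 lo nloz hlo; have h2 := lt1 hi nhiz hhi.
have hz : rstep (@wqo_le X) true (residual (@wqo_le X) true S z) S by exists z.
set r1 := rk true (fun x => residual _ _ _ _ _ /\ ~ lo x) in h1.
set r2 := rk true (fun x => residual _ _ _ _ _ /\ ~ hi x) in h2.
(* Here [z] lies in neither set, so both bounds have dropped below [a]; the induction continues with
   the larger one. *)
case: (leO_or_ltO r1 r2) => h12.
  by apply: leO_ltO_trans h2; apply: IH.
by apply: leO_ltO_trans h1; apply: IH => //; apply: ltO_leO.
Qed.

(** * Ranks of forests of finite sequences *)

Fixpoint chained (X : Type) (Q : X -> X -> Prop) (l : list X) : Prop :=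
  match l with nil => True | x :: t => lall (Q x) t /\ chained Q t end.

Lemma lall_In (X : Type) (p : X -> Prop) l : lall p l <-> forall x, List.In x l -> p x.
Proof.
elim: l => [|y t IH] /=; first by split.
split=> [[py /IH h] x [<-|] //|h]; first exact: h.
by split; [apply: h; left | apply/IH => x xt; apply: h; right].
Qed.

Lemma lall_rcons (X : Type) (p : X -> Prop) l x : lall p (rcons l x) <-> lall p l /\ p x.
Proof. by elim: l => [|y t IH] /=; [split=> [[]|[]] | rewrite IH; split=> [[? []]|[[]]]]. Qed.

Lemma chained_rcons (X : Type) (Q : X -> X -> Prop) l x :
  chained Q (rcons l x) <-> chained Q l /\ lall (fun y => Q y x) l.
Proof.
elim: l => [|y t IH] /=; first by split.
by rewrite lall_rcons IH; split=> [[[? ?] []]|[[? ?] []]].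
Qed.

Section ForestRank.
Variables (X : wqo) (v : bool).
Local Notation Q := (follows (@wqo_le X) v).
Local Notation res := (residual (@wqo_le X) v).

Definition after (s : list X) : X -> Prop := fun x => lall (fun y => Q y x) s.

Lemma after_rcons s x : after (rcons s x) = res (after s) x.
Proof.
apply: functional_extensionality => y; apply: propositional_extensionality.
by rewrite /after lall_rcons.
Qed.

Lemma Acc_fchild s : Acc (fchild (chained Q)) s.
Proof.
move E: (after s) => S; elim/(well_founded_ind (rstep_wf (X := X) v)): S s E => S IH s E.
constructor=> t [/[swap] -[x ->] /chained_rcons [_ hx]].
by apply: (IH (after (rcons s x))) => //; exists x; rewrite // -E // after_rcons.
Qed.

(** Recursion is on the [Acc] proof, as in [acc_rank]; the resulting value does not depend on that
    proof. *)
Lemma acc_rank_rk s (h : Acc (fchild (chained Q)) s) : chained Q s ->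
  cls (acc_rank h) = rk v (after s).
Proof.
revert s h; fix IH 2 => s [hf] Ps /=.
have e t (ht : fchild (chained Q) t s) : cls (acc_rank (hf t ht)) = rk v (after t).
  by apply: IH; case: ht.
clear IH; apply: leO_anti.
  rewrite -(repK (rk v _)); apply/cls_le; case E: (rep _) => [J g] [t ht].
  have: rk v (after t) <o rk v (after s).
    case: (ht) => Pt [x et]; move: Pt; rewrite et after_rcons => /chained_rcons [_ hx].
    exact: rk_res_lt.
  by rewrite -(e t ht) -(repK (rk v (after s))) E => /cls_lt.
apply/rk_le => z hz; rewrite -after_rcons.
have ht : fchild (chained Q) (rcons s z) s.
  by split; [apply/chained_rcons | exists z].
rewrite -(e _ ht); apply/cls_lt.
by exists (exist (fun t => fchild (chained Q) t s) _ ht); apply: ole_refl.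
Qed.

(** The rank of the whole set is that of the missing root [nil]: it exceeds every node, and the
    one-element sequences suffice to reach it. *)
Lemma forest_inv_rk : cls (forest_inv (chained Q)) = rk v (fun _ : X => True).
Proof.
apply: leO_anti.
  rewrite -(repK (rk v _)); apply/cls_le; case E: (rep _) => [J g] [s [[Ps s0] hs]] /=.
  suff: rk v (after s) <o rk v (fun _ : X => True).
    by rewrite -(acc_rank_rk hs Ps) -(repK (rk v (fun _ => True))) E => /cls_lt h; rewrite (proof_irrelevance _ (proj2 _) hs); exact: h.
  case: s s0 Ps {hs} => // x t _ _.
  apply: leO_ltO_trans (rk_res_lt (z := x) v _) => //.
  by apply: rk_sub => y [].
apply/rk_le => z _; have -> : residual (@wqo_le X) v (fun _ => True) z = after [:: z].
  apply: functional_extensionality => y; apply: propositional_extensionality.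
  by split=> [[]|[]].
have hP : chained Q [:: z] by [].
have hz : (chained Q [:: z] /\ [:: z] <> nil) /\ Acc (fchild (chained Q)) [:: z].
  by split; last exact: Acc_fchild.
rewrite -(acc_rank_rk (proj2 hz) hP); apply/cls_lt.
exists (exist (fun s => (chained Q s /\ s <> nil) /\ Acc (fchild (chained Q)) s) _ hz); apply: ole_refl.
Qed.
End ForestRank.

Lemma chained_bad (X : Type) (le : X -> X -> Prop) : chained (follows le false) = bad le.
Proof.
have e : follows le false = fun x y => ~ le x y.
  by do 2 (apply: functional_extensionality => ?); apply: propositional_extensionality; split=> [[]|].
rewrite e; apply: functional_extensionality; elim=> //= x t IH; by rewrite IH.
Qed.

Lemma chained_antichain (X : Type) (le : X -> X -> Prop) :
  chained (follows le true) = antichain le.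
Proof.
have e : follows le true = fun x y => ~ le x y /\ ~ le y x.
  do 2 (apply: functional_extensionality => ?); apply: propositional_extensionality.
  by split=> [[h /(_ isT)]|[]].
rewrite e; apply: functional_extensionality; elim=> //= x t IH; by rewrite IH.
Qed.

Lemma width_eq_mot (X : wqo) :
  oeq (width (@wqo_le X)) (mot (@wqo_le X)) <->
  rk true (fun _ : X => True) = rk false (fun _ : X => True).
Proof.
by rewrite -!forest_inv_rk chained_bad chained_antichain cls_eq.
Qed.

(** * The well-order omega^B *)

Lemma wo_asym (W : woset) (x y : W) : wo_lt x y -> ~ wo_lt y x.
Proof. by move=> h1 h2; apply: (@wo_irr W x); apply: wo_trans h1 h2. Qed.

Lemma wo_le_or_lt (W : woset) (x y : W) : wo_le x y \/ wo_lt y x.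
Proof. by case: (wo_total x y) => [|[]]; [left; left | left; right | right]. Qed.

Lemma wo_le_refl (W : woset) (x : W) : wo_le x x.
Proof. by right. Qed.
Hint Resolve wo_le_refl : core.

Lemma wo_le_trans (W : woset) (y x z : W) : wo_le x y -> wo_le y z -> wo_le x z.
Proof. by move=> [xy|->] // [yz|<-]; left=> //; apply: wo_trans xy yz. Qed.

Lemma wo_le_lt_trans (W : woset) (y x z : W) : wo_le x y -> wo_lt y z -> wo_lt x z.
Proof. by move=> [xy|->] // yz; apply: wo_trans xy yz. Qed.

Lemma wo_lt_le_trans (W : woset) (y x z : W) : wo_lt x y -> wo_le y z -> wo_lt x z.
Proof. by move=> xy [yz|<-] //; apply: wo_trans xy yz. Qed.

Lemma wo_lt_nge (W : woset) (x y : W) : wo_lt x y <-> ~ wo_le y x.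
Proof.
split=> [xy [yx|e]|h]; first exact: wo_asym xy yx.
  by subst; apply: wo_irr xy.
by case: (wo_le_or_lt y x).
Qed.

Lemma wo_le_nlt (W : woset) (x y : W) : wo_le x y <-> ~ wo_lt y x.
Proof. by split=> [h /wo_lt_nge|h] //; case: (wo_le_or_lt x y). Qed.

Lemma wo_least (W : woset) (P : W -> Prop) : (exists x, P x) ->
  exists2 x, P x & forall y, P y -> wo_le x y.
Proof.
move=> [x]; elim/(well_founded_ind (@wo_wf W)): x => x IH Px.
case: (classic (exists2 y, P y & wo_lt y x)) => [[y Py yx]|h]; first exact: IH yx Py.
by exists x => // y Py; apply/wo_le_nlt => yx; case: h; exists y.
Qed.

Lemma finite_max (W : woset) (P : W -> Prop) (l : list W) :
  (exists2 x, List.In x l & P x) ->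
  exists m, P m /\ forall y, List.In y l -> P y -> wo_le y m.
Proof.
elim: l => [[x []]|a l IH [x /= xl Px]].
case: (classic (exists2 x, List.In x l & P x)) => [/IH [m [Pm hm]]|hn]; last first.
  have {}hn y : List.In y l -> P y -> False by move=> yl Py; case: hn; exists y.
  case: xl => [e|/hn/(_ Px)[]]; exists x; split=> // y [<-|/hn h /h //] _.
  by right.
case: (classic (P a /\ wo_lt m a)) => [[Pa ma]|h].
  exists a; split=> // y [<- //|yl Py]; left; exact: wo_le_lt_trans (hm y yl Py) ma.
by exists m; split=> // y [<- Pa|yl Py]; [apply/wo_le_nlt => ma; case: h | exact: hm].
Qed.

Lemma wo_mono_infl (W : woset) (h : W -> W) :
  (forall x y, wo_lt x y -> wo_lt (h x) (h y)) -> forall x, wo_le x (h x).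
Proof.
move=> hm x; elim/(well_founded_ind (@wo_wf W)): x => x IH.
apply/wo_le_nlt => hx; have := IH _ hx; move/wo_le_nlt; apply; exact: hm.
Qed.

Notation "f .@ x" := (proj1_sig f x) (at level 2, format "f .@ x").

Section Pow.
Variable B : woset.
Local Notation car := (omega_pow_car B).
Local Notation lt := (@omega_pow_lt B (@wo_lt B)).
Implicit Types f g h : car.

Lemma pow_eq f g : (forall x, f.@x = g.@x) -> f = g.
Proof. by move=> e; apply: sig_eq; apply: functional_extensionality. Qed.

Lemma pow_irr f : ~ lt f f.
Proof. by move=> [x []]; rewrite ltnn. Qed.

Lemma pow_trans f g h : lt f g -> lt g h -> lt f h.
Proof.
move=> [x [fx hx]] [y [gy hy]]; case: (wo_total x y) => [xy|[e|yx]].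
- exists y; split; first by rewrite hx.
  by move=> z yz; rewrite hx ?hy //; apply: wo_trans xy yz.
- subst y; exists x; split; first exact: ltn_trans fx gy.
  by move=> z xz; rewrite hx ?hy.
- exists x; split; first by rewrite -hy.
  by move=> z xz; rewrite hx ?hy //; apply: wo_trans yx xz.
Qed.

Lemma pow_total f g : lt f g \/ f = g \/ lt g f.
Proof.
case: (classic (forall x, f.@x = g.@x)) => [/pow_eq|/not_all_ex_not [x hx]]; first by right; left.
have [[l hl] [l' hl']] := (proj2_sig f, proj2_sig g).
have dl y : f.@y <> g.@y -> List.In y (l ++ l').
  move=> hy; apply/List.in_or_app.
  case E: (f.@y) hy => [|k] hy; last by left; apply: hl; rewrite E.
  by right; apply: hl' => e; apply: hy.
have [m [hm hmax]] := @finite_max B (fun y => f.@y <> g.@y) (l ++ l')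
  (ex_intro2 _ _ x (dl x hx) hx).
have eqm y : wo_lt m y -> f.@y = g.@y.
  move=> my; apply: NNPP => hy; have := hmax y (dl y hy) hy.
  by move/wo_le_nlt.
case: (ltngtP (f.@m) (g.@m)) => // c; [left|right; right]; exists m; split=> // y my.
by rewrite eqm.
Qed.

Lemma pow_max f : (exists x, f.@x <> 0) ->
  exists m, f.@m <> 0 /\ forall x, f.@x <> 0 -> wo_le x m.
Proof.
move=> [x hx]; have [l hl] := proj2_sig f.
have [m [hm hmax]] := @finite_max B (fun y => f.@y <> 0) l (ex_intro2 _ _ x (hl x hx) hx).
by exists m; split=> // y hy; apply: hmax => //; apply: hl.
Qed.

Lemma fin_supp_sub (f : car) (p : B -> nat) : (forall x, f.@x = 0 -> p x = 0) -> fin_supp p.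
Proof.
move=> h; have [l hl] := proj2_sig f; exists l => x px; apply: hl => /h //.
Qed.

Definition below b f : B -> nat := fun x => if asb (wo_lt x b) then f.@x else 0.

Lemma below_supp b f : fin_supp (below b f).
Proof. by apply: (fin_supp_sub (f := f)) => x e; rewrite /below e; case: ifP. Qed.

Definition low b f : car := exist _ (below b f) (below_supp b f).

Lemma low_lt b f x : wo_lt x b -> (low b f).@x = f.@x.
Proof. by rewrite /= /below => /asbP ->. Qed.

Lemma low_ge b f x : wo_le b x -> (low b f).@x = 0.
Proof. by move=> /wo_le_nlt h; rewrite /= /below; case: asbP. Qed.

Lemma zero_supp : @fin_supp B (fun _ => 0).
Proof. by exists [::]. Qed.

Definition pzero : car := exist _ _ zero_supp.

Lemma lt_pzero f : ~ lt f pzero.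
Proof. by move=> [x []]. Qed.

Lemma pow_supp_zero f : ~ (exists x, f.@x <> 0) -> f = pzero.
Proof. by move=> h; apply: pow_eq => x; apply: NNPP => hx; apply: h; exists x. Qed.

(** Three nested inductions: on the bound [m] of the exponents, on the coefficient at [m], and on
    the part below omega^m, which is accessible by the first induction. *)
Lemma pow_acc_supp m f : (forall x, f.@x <> 0 -> wo_le x m) -> Acc lt f.
Proof.
elim/(well_founded_ind (@wo_wf B)): m f => m IHm.
have acc_low f : Acc lt (low m f).
  case: (classic (exists x, (low m f).@x <> 0)) => [h|/pow_supp_zero ->].
    have [b [hb hmax]] := pow_max h; apply: (IHm b) => //.
    by apply: NNPP => hn; apply: hb; apply: low_ge; apply/wo_le_nlt.
  by constructor=> g /lt_pzero.
suff: forall k f, (forall x, f.@x <> 0 -> wo_le x m) -> f.@m = k -> Acc lt f.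
  by move=> h f hf; apply: h hf erefl.
elim/ltn_ind => k IHk f hf fk.
move: (acc_low f) hf fk; move E: (low m f) => l accl; elim: accl f E => {}l _ IHl f E hf fk.
constructor=> g [x [gx hx]].
have xm : wo_le x m by apply: hf => e; rewrite e in gx.
have hg y : g.@y <> 0 -> wo_le y m.
  move=> gy; case: (wo_le_or_lt y m) => // my.
  by rewrite hx in gy; [apply: hf | apply: wo_le_lt_trans my].
case: xm => [xm|e]; last by subst x; apply: (IHk (g.@m)) => //; rewrite -fk.
apply: (IHl (low m g)) => //; last by rewrite hx.
rewrite -E; exists x; rewrite !low_lt //; split=> // y xy.
case: (wo_le_or_lt m y) => ym; first by rewrite !low_ge.
by rewrite !low_lt // hx.
Qed.

Lemma pow_wf : well_founded lt.
Proof.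
move=> f; case: (classic (exists x, f.@x <> 0)) => [h|/pow_supp_zero ->].
  by have [m [_ hm]] := pow_max h; apply: pow_acc_supp hm.
by constructor=> g /lt_pzero.
Qed.

Definition Pow : woset := WOSet pow_irr pow_trans pow_total pow_wf.

Lemma mono_supp b c : @fin_supp B (fun x => if asb (x = b) then c else 0).
Proof. by exists [:: b] => x; case: asbP => // ->; left. Qed.

(* [mono b c] is omega^b * c *)
Definition mono b c : Pow := exist _ _ (mono_supp b c).
Definition om b : Pow := mono b 1.

Lemma mono_at b c : (mono b c).@b = c.
Proof. by rewrite /=; case: asbP. Qed.

Lemma mono_out b c x : x <> b -> (mono b c).@x = 0.
Proof. by rewrite /=; case: asbP. Qed.

Lemma add_supp f g : @fin_supp B (fun x => f.@x + g.@x).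
Proof.
have [[l hl] [l' hl']] := (proj2_sig f, proj2_sig g).
exists (l ++ l') => x h; apply/List.in_or_app.
by case E: (f.@x) h => [|k] h; [right; apply: hl' | left; apply: hl; rewrite E].
Qed.

(** Natural sum of normal forms. Unlike the ordinal sum it is commutative and strictly monotone on
    either side, so translations reflect the order. *)
Definition padd (f g : Pow) : Pow := exist _ _ (add_supp f g).

Lemma padd_lt (f g g' : Pow) : wo_lt (padd f g) (padd f g') <-> wo_lt g g'.
Proof.
split=> -[x [hx hm]]; exists x; rewrite /= ?ltn_add2l in hx *; split=> // y xy.
  by move: (hm y xy) => /= /addnI.
by rewrite /= hm.
Qed.

Lemma padd_le (f g g' : Pow) : wo_le (padd f g) (padd f g') <-> wo_le g g'.
Proof. by rewrite !wo_le_nlt padd_lt. Qed.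

Lemma pzero_le (f : Pow) : wo_le (pzero : Pow) f.
Proof. by apply/wo_le_nlt; apply: lt_pzero. Qed.

Lemma padd0 (f : Pow) : padd f pzero = f.
Proof. by apply: pow_eq => x /=; rewrite addn0. Qed.

Lemma le_padd (f g : Pow) : wo_le f (padd f g).
Proof. by rewrite -{1}(padd0 f); apply/padd_le/pzero_le. Qed.

Lemma paddC (f g : Pow) : padd f g = padd g f.
Proof. by apply: pow_eq => x /=; rewrite addnC. Qed.

Lemma le_paddr (f g : Pow) : wo_le f (padd g f).
Proof. by rewrite paddC; apply: le_padd. Qed.

Lemma lt_om b (g : Pow) : wo_lt g (om b) <-> forall x, g.@x <> 0 -> wo_lt x b.
Proof.
split=> [[x [gx hx]]|h].
  have e : x = b by apply: NNPP => hn; rewrite mono_out in gx.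
  subst x; rewrite mono_at ltnS leqn0 in gx; move/eqP: gx => gb.
  move=> x gx0; case: (wo_total x b) => [//|[e|bx]]; first by subst.
  case: gx0; rewrite hx // mono_out // => e; subst; exact: wo_irr bx.
have z x : wo_le b x -> g.@x = 0 by move/wo_le_nlt => hn; apply: NNPP => /h.
exists b; rewrite z // mono_at; split=> // y by_; rewrite z; last by left.
by rewrite mono_out // => e; subst; exact: wo_irr by_.
Qed.

Lemma lt_om_ge b (g : Pow) x : wo_lt g (om b) -> wo_le b x -> g.@x = 0.
Proof. by move=> /lt_om h /wo_le_nlt hn; apply: NNPP => /h. Qed.

Lemma padd_lt_om b (f g : Pow) : wo_lt f (om b) -> wo_lt g (om b) -> wo_lt (padd f g) (om b).
Proof.
move=> /lt_om hf /lt_om hg; apply/lt_om => x /=.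
by case E: (f.@x) => [|k] h; [apply: hg | apply: hf; rewrite E].
Qed.

Lemma om_lt b b' : wo_lt b b' -> wo_lt (om b) (om b').
Proof.
move=> h; apply/lt_om => x; case: (classic (x = b)) => [-> //|/mono_out e].
by rewrite /om e.
Qed.

Lemma om_le b b' : wo_le b b' -> wo_le (om b) (om b').
Proof. by case=> [/om_lt|->]; [left | right]. Qed.

Lemma low_om b (f : Pow) : wo_lt (low b f : Pow) (om b).
Proof.
apply/lt_om => x; case: (wo_le_or_lt b x) => // h.
by rewrite low_ge.
Qed.

Lemma pzero_lt_om b : wo_lt (pzero : Pow) (om b).
Proof. by apply/lt_om. Qed.

Lemma supp_le_om (f : Pow) b : f.@b <> 0 -> wo_le (om b) f.
Proof. by move=> h; apply/wo_le_nlt => /lt_om /(_ _ h); apply: wo_irr. Qed.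

Lemma pow_nonzero (f : Pow) : f <> pzero -> exists x, f.@x <> 0.
Proof. by move=> h; apply: NNPP => /pow_supp_zero. Qed.

Lemma pzero_lt (f : Pow) : f <> pzero -> wo_lt (pzero : Pow) f.
Proof. by move=> h; case: (pzero_le f) => // e; case: h. Qed.
End Pow.

(** * Cantor normal forms as decompositions of initial segments *)

(* The initial segment below [f] is the concatenation of the blocks
   [pos = 0], ..., [pos = N], the block [pos = l] having order type [omega^(e l)]. *)
Record Dec (B : woset) (f : Pow B) (N : nat) (e : nat -> B) (pos : Pow B -> nat) : Prop := {
  dec_pos : forall g, wo_lt g f -> pos g <= N;
  dec_mono : forall g g', wo_le g g' -> wo_lt g' f -> pos g <= pos g';
  dec_anti : forall l l', l <= l' -> l' <= N -> wo_le (e l') (e l);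
  dec_supp : forall l, l <= N -> f.@(e l) <> 0;
  dec_min : forall x, f.@x <> 0 -> wo_le (e N) x;
  dec_up : forall l, l <= N -> exists h : Pow B -> Pow B,
    (forall g, wo_lt g (om (e l)) -> wo_lt (h g) f /\ pos (h g) = l) /\
    (forall g g', wo_lt g' (om (e l)) -> wo_lt g g' -> wo_lt (h g) (h g'));
  dec_down : forall l, l <= N -> exists h : Pow B -> Pow B,
    (forall g, wo_lt g f -> pos g = l -> wo_lt (h g) (om (e l))) /\
    (forall g g', wo_lt g f -> pos g = l -> wo_lt g' f -> pos g' = l ->
       wo_lt g g' -> wo_lt (h g) (h g'))
}.

Section DecExists.
Variable B : woset.
Implicit Types f g : Pow B.

Lemma peel_last f : f <> pzero B -> exists b f',
  [/\ f = padd f' (om b), f.@b <> 0, forall x, f.@x <> 0 -> wo_le b x &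
      forall x, wo_lt x b -> f'.@x = 0].
Proof.
move=> /pow_nonzero /wo_least [b fb bmin].
have supp : @fin_supp B (fun x => f.@x - (om b).@x).
  by apply: (fin_supp_sub (f := f)) => x ->.
exists b, (exist _ _ supp); split=> //.
  apply: pow_eq => x; rewrite /padd.
  change (f.@x = f.@x - (om b).@x + (om b).@x); rewrite subnK //.
  case: (classic (x = b)) => [->|h]; first by rewrite mono_at lt0n; apply/eqP.
  by rewrite mono_out.
move=> x xb; change (f.@x - (om b).@x = 0).
case E: (f.@x) => [|k] //; have := bmin x; rewrite E => /(_ (fun e => O_S _ (esym e))).
by move/wo_le_nlt.
Qed.

(** Since [f'] has no exponent below [b], adding a part below omega^b is plain concatenation: the
    interval from [f'] to f' + omega^b is a translate of omega^b. *)
Lemma block_split f' b g : (forall x, wo_lt x b -> f'.@x = 0) ->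
  wo_le f' g -> wo_lt g (padd f' (om b)) -> g = padd f' (low b g).
Proof.
move=> hf' /wo_le_nlt f'g [y]; change ((padd f' (om b)).@y) with (f'.@y + (om b).@y) => -[gy hy].
have {}hy x : wo_lt y x -> g.@x = f'.@x + (om b).@x by move=> yx; rewrite hy.
case: (wo_total y b) => [yb|[e|by_]].
- rewrite hf' // mono_out // in gy => e; subst; exact: wo_irr yb.
- subst y; rewrite mono_at addn1 ltnS in gy.
  have eqa x : wo_lt b x -> g.@x = f'.@x.
    by move=> bx; rewrite hy // mono_out ?addn0 // => e; subst; exact: wo_irr bx.
  have eqb : g.@b = f'.@b.
    apply/eqP; rewrite eqn_leq gy leqNgt; apply/negP => lt; apply: f'g.
    by exists b; split.
  apply: pow_eq => x; change (g.@x = f'.@x + (low b g).@x).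
  case: (wo_total x b) => [xb|[->|bx]].
  + by rewrite hf' // low_lt.
  + by rewrite low_ge // addn0.
  + by rewrite low_ge ?addn0; [exact: eqa | left].
- case: f'g; exists y; split.
    by rewrite mono_out ?addn0 // in gy => e; subst; exact: wo_irr by_.
  move=> x yx; rewrite hy // mono_out ?addn0 // => e; subst; exact: wo_asym by_ yx.
Qed.

Lemma low_mono_block f' b g g' : (forall x, wo_lt x b -> f'.@x = 0) ->
  wo_le f' g -> wo_lt g (padd f' (om b)) -> wo_le f' g' -> wo_lt g' (padd f' (om b)) ->
  wo_lt g g' -> wo_lt (low b g : Pow B) (low b g').
Proof.
move=> hf' h1 h2 h3 h4; rewrite (block_split hf' h1 h2) (block_split hf' h3 h4) padd_lt.
by rewrite -(block_split hf' h1 h2) -(block_split hf' h3 h4).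
Qed.

Lemma om_dec (b : B) : Dec (om b) 0 (fun _ => b) (fun _ => 0).
Proof.
split=> //.
- by move=> l _; rewrite mono_at.
- move=> x; case: (classic (x = b)) => [-> //|/mono_out]; by rewrite /om => ->.
- move=> l; rewrite leqn0 => /eqP ->; by exists id.
- move=> l; rewrite leqn0 => /eqP ->; by exists id.
Qed.

Lemma dec_exists f : f <> pzero B ->
  exists N e pos, Dec f N e pos /\ (N = 0 <-> exists b, f = om b).
Proof.
elim/(well_founded_ind (@wo_wf (Pow B))): f => f IH f0.
case: (classic (exists b, f = om b)) => [[b ->]|nom].
  by exists 0, (fun _ => b), (fun _ => 0); split; [apply: om_dec | split=> // _; exists b].
have [b [f' [ef fb bmin hf']]] := peel_last f0.
have f'f : wo_lt f' f.
  by rewrite ef -{1}(padd0 f'); apply/padd_lt/pzero_lt_om.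
have f'0 : f' <> pzero B.
  by move=> e; case: nom; exists b; rewrite ef e paddC padd0.
have [N [e [pos [D _]]]] := IH f' f'f f'0.
have suppf x : f'.@x <> 0 -> f.@x <> 0.
  by rewrite ef; change ((padd f' (om b)).@x) with (f'.@x + (om b).@x); case: (f'.@x).
(* The peeled copy of omega^b becomes the last block and covers the points from [f'] on; earlier
   points keep their position in the decomposition of [f']. *)
exists N.+1, (fun l => if l <= N then e l else b), (fun g => if asb (wo_lt g f') then pos g else N.+1).
split; last by split=> // -[c efc]; case: nom; exists c.
have posN g : ((if asb (wo_lt g f') then pos g else N.+1) = N.+1) <-> wo_le f' g.
  rewrite wo_le_nlt; case: asbP => h; last by split.
  by split=> // epos; have := dec_pos D h; rewrite epos ltnn.
have posS g l : l <= N ->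
    ((if asb (wo_lt g f') then pos g else N.+1) = l) <-> wo_lt g f' /\ pos g = l.
  move=> lN; case: asbP => h; first by split=> [|[]].
  by split=> [el|[/h]] //; rewrite -el ltnn in lN.
split.
- by move=> g _; case: asbP => // /(dec_pos D) /leqW.
- move=> g g' gg' g'f; case: (asbP (wo_lt g' f')) => h.
    case: asbP => h'; first exact: dec_mono D _ _ _ _.
    by case: h'; apply: wo_le_lt_trans gg' h.
  by case: asbP => // /(dec_pos D) /leqW.
- move=> l l' ll' l'N; case: leqP => h'.
    by rewrite (leq_trans ll' h'); apply: dec_anti D _ _ _ _.
  case: leqP => // h; apply: bmin; apply: suppf; exact: dec_supp D _ _.
- move=> l lN; case: leqP => // h; apply: suppf; exact: dec_supp D _ _.
- by move=> x /bmin; rewrite ltnn.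
- move=> l; rewrite leq_eqVlt => /orP [/eqP ->|]; last first.
    rewrite ltnS => lN; rewrite lN; have [h [h1 h2]] := dec_up D lN.
    exists h; split=> // g /h1 [hf hp]; split; first exact: wo_trans hf f'f.
    by apply/posS.
  rewrite ltnn; exists (padd f'); split=> [g hg|g g' _ gg']; last exact/padd_lt.
  split; first by rewrite ef; apply/padd_lt.
  by apply/posN/le_padd.
- move=> l; rewrite leq_eqVlt => /orP [/eqP ->|]; last first.
    rewrite ltnS => lN; rewrite lN; have [h [h1 h2]] := dec_down D lN.
    exists h; split=> [g gf /(posS _ _ lN) []|]; first exact: h1.
    by move=> g g' _ /(posS _ _ lN) [? ?] _ /(posS _ _ lN) [? ?]; apply: h2.
  rewrite ltnn; exists (fun g => low b g); split=> [g gf _|g g']; first exact: low_om.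
  rewrite !posN => gf f'g g'f f'g'; rewrite ef in gf g'f.
  exact: (low_mono_block hf' f'g gf f'g' g'f).
Qed.
End DecExists.

(** * Products of well-orders *)

Section ProdWf.
Variables (I : finType) (W : I -> woset).

Definition prod_le (x y : forall i, W i) : Prop := forall i, wo_le (x i) (y i).

(** Coordinates are ranked, and a box is measured by the natural sum of its sides. Whatever is not
    above a point [y] of a box lies in finitely many boxes with one side cut down to [y]. *)
Lemma prod_wf : well_founded (rstep prod_le false).
Proof.
have /fin_all_exists [r hr] i : exists r : W i -> On, forall x y, wo_lt x y -> r x <o r y.
  exact: wf_rank (@wo_wf (W i)).
have accD : forall u : I -> On, Acc (rstep prod_le false) (fun x => forall i, r i (x i) <o u i).
  move=> u; move E: (\osum_(i : I) u i) => s.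
  elim/(well_founded_ind ltO_wf): s u E => s IH u E.
  constructor=> _ [y Dy ->].
  pose F i x := r i (x i) <o r i (y i) /\ forall j, r j (x j) <o u j.
  have accF i : Acc (rstep prod_le false) (F i).
    pose u' j := if j == i then r i (y i) else u j.
    have acc' : Acc (rstep prod_le false) (fun x => forall j, r j (x j) <o u' j).
      apply: (IH (\osum_(j : I) u' j)) => //; rewrite -E.
      by apply: (osum_lt (i0 := i)) => [j|]; rewrite /u' ?eqxx //; case: eqP => // ->; apply: ltO_leO.
    apply: (Acc_rstep_sub acc') => x [h1 h2] j.
    by rewrite /u'; case: eqP => // ->.
  have accU (s' : seq I) : Acc (rstep prod_le false) (fun x => exists2 i, i \in s' & F i x).
    elim: s' => [|i s' IHs]; first by constructor=> ? [z [j]].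
    apply: Acc_rstep_union (accF i) IHs _ => x [j].
    by rewrite inE => /orP [/eqP ->|js] Fj; [left | right; exists j].
  apply: (Acc_rstep_sub (accU (enum I))) => x [Dx [yx _]].
  have [i /wo_lt_nge xy] := not_all_ex_not _ _ yx.
  by exists i; rewrite ?mem_enum //; split=> //; apply: hr.
move=> S; apply: (Acc_rstep_sub (accD (fun i => osup (r i)))) => x _ i.
exact: lt_osup.
Qed.

Definition ProdW : wqo := Wqo prod_wf.

Lemma rk_coord v (S S' : ProdW -> Prop) (h : forall i, W i -> W i) :
  (forall x, S x -> S' (fun i => h i (x i))) ->
  (forall x y i, S x -> S y -> wo_lt (x i) (y i) -> wo_lt (h i (x i)) (h i (y i))) ->
  rk v S <=o rk v S'.
Proof.
move=> hS hm; apply: (@rk_map ProdW ProdW v S S' (fun x i => h i (x i))) => // x y Sx Sy hle i.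
apply/wo_le_nlt => yx; have /wo_le_nlt := hle i; apply; exact: hm.
Qed.
End ProdWf.

(** * A lower bound from quasi-incomparable blocks *)

Lemma lall_sub (T : Type) (p q : T -> Prop) l : (forall x, p x -> q x) -> lall p l -> lall q l.
Proof. by move=> pq; elim: l => //= x l IH [/pq ? /IH]. Qed.

Section Blocks.
Variables (X : wqo) (v : bool) (L : finType) (leL : rel L) (ht : L -> nat).
Variables (t : L -> On) (Sl : L -> X -> Prop) (S : X -> Prop).
Hypothesis leL_ht : forall k l, leL k l -> k != l -> ht k < ht l.
Hypothesis t_anti : forall k l, leL k l -> t l <=o t k.
Hypothesis t_closed : forall l, closedO (t l).
Hypothesis SlS : forall l x, Sl l x -> S x.
(* However the blocks not below [l] have been used, a copy of rank [t l] survives in block [l]. *)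
Hypothesis escape : forall Y l,
  lall (fun y => exists2 k, ~~ leL k l & Sl k y) Y ->
  t l <=o rk v (fun x => Sl l x /\ after v Y x).

(* The remaining blocks [D] form a down-set, and the current position still offers
   rank [a], smaller than every remaining [t l], inside the blocks already opened.
   To decrease some [t j] one jumps to a maximal block [j'] with [t j' = t j]; as
   [t j] is additively closed, everything smaller that is lost fits in that block. *)
Lemma blocks_state s (D : {set L}) Y (V : X -> Prop) a :
  hadd (\osum_(l | l \in D) t l) a = s ->
  (forall k l, leL k l -> l \in D -> k \in D) ->
  lall (fun y => exists2 k, k \notin D & Sl k y) Y ->
  (forall x, V x -> exists2 k, k \notin D & Sl k x) ->
  (forall l, l \in D -> a <o t l) ->
  a <=o rk v (fun x => V x /\ after v Y x) ->
  s <=o rk v (fun x => S x /\ after v Y x).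
Proof.
elim/(well_founded_ind ltO_wf): s D Y V a => s IH D Y V a Es downD YD VD aD aV.
apply: le_rk => c; rewrite -Es => /lt_hadd [] [w hw cw]; last first.
  have [z [Vz Yz] hz] := lt_rk (ltO_leO_trans hw aV).
  have [k kD Sz] := VD z Vz.
  exists z; first by split=> //; apply: SlS Sz.
  apply: leO_trans cw _; apply: leO_trans (IH _ _ D (rcons Y z) V w erefl _ _ _ _ _) _ => //.
  - by rewrite -Es; apply: hadd_lt_r.
  - by apply/lall_rcons; split=> //; exists k.
  - by move=> l /aD; apply: ltO_trans.
  - apply: leO_trans hz _; apply: rk_sub => x [[Vx Yx] zx]; split=> //.
    by apply/lall_rcons.
  - apply: rk_sub => x [Sx /lall_rcons [Yx zx]]; split=> //.
have [j [r [jD rj hw']]] := lt_osum hw.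
pose p l := (l \in D) && asb (t l = t j).
have pj : p j by rewrite /p jD; apply/asbP.
(* Among the remaining blocks with the value of [j], one of greatest height is opened: no block
   above it with this value remains, so [D'] is again a down-set. Exchanging [j] for [j'] does not
   change the sum. *)
case: (arg_maxnP ht pj) => j' /andP [j'D /asbP tj'] j'max.
pose big l := asb (t j <=o t l).
(* Only blocks of value at least [t j] stay ahead. The smaller ones are given up: their sum [rest],
   together with [r] and [a], is below [t j] by closure and is recovered inside [j']. *)
pose D' := [set l in D :\ j' | big l].
set rest := \osum_(l | (l \in D :\ j') && ~~ big l) t l.
have tj0 : zeroO <o t j by apply: leO_ltO_trans rj.
have rest_lt : rest <o t j.
  by apply: closedO_osum => // l /andP [_ /asbP] /ltO_nge.
have split_D : \osum_(l | l \in D :\ j') t l = hadd (\osum_(l | l \in D') t l) rest.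
  rewrite (bigID big) /=; congr hadd; apply: eq_bigl => l.
  by rewrite [in RHS]inE.
have swap : \osum_(l | l \in D :\ j) t l = \osum_(l | l \in D :\ j') t l.
  case: (eqVneq j j') => [-> //|jj'].
  rewrite (big_setD1 j') /= ?inE 1?eq_sym ?jj' // [RHS](big_setD1 j) /= ?inE ?jj' //.
  by rewrite tj' !setDDl setUC.
pose a' := hadd (hadd rest r) a.
have a'j : a' <o t j by do 2?apply: t_closed => //; apply: aD.
have YD' : lall (fun y => exists2 k, ~~ leL k j' & Sl k y) Y.
  apply: lall_sub YD => y [k kD Sy]; exists k => //.
  by apply/negP => /downD/(_ j'D); apply/negP.
have tV := escape YD'.
rewrite tj' in tV; have [z [Sz Yz] hz] := lt_rk (ltO_leO_trans a'j tV).
exists z; first by split=> //; apply: SlS Sz.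
have DD' l : l \notin D -> l \notin D' by rewrite !inE => /negbTE ->; rewrite andbF.
have j'D' : j' \notin D' by rewrite !inE eqxx.
apply: leO_trans (leO_trans cw (hadd_mono hw' (leO_refl a))) _.
rewrite swap split_D -!haddA (haddA rest) -/a'.
apply: leO_trans (IH _ _ D' (rcons Y z) (Sl j') a' erefl _ _ _ _ _) _.
- rewrite -Es [X in _ <o hadd X _](big_setD1 j') //= split_D.
  apply: ltO_leO_trans (hadd_lt_r _ a'j) _.
  rewrite tj' haddC -haddA; apply: hadd_mono => //.
  by rewrite -haddA; apply: le_haddl.
- move=> k l kl; rewrite !inE => /andP [/andP [lj' lD] /asbP tl].
  have kD := downD _ _ kl lD; have tlk := t_anti kl.
  have bk : big k by apply/asbP; apply: leO_trans tl tlk.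
  rewrite kD bk !andbT.
  apply/eqP => ek; subst k; have := leL_ht kl; rewrite eq_sym lj' => /(_ isT).
  rewrite ltnNge => /negP; apply; apply: j'max; rewrite /p lD; apply/asbP.
  by apply: leO_anti => //; rewrite -tj'.
- apply/lall_rcons; split; last by exists j'.
  by apply: lall_sub YD => y [k /DD']; exists k.
- by move=> x Sx; exists j'.
- by move=> l; rewrite !inE => /andP [_ /asbP]; apply: ltO_leO_trans.
- apply: leO_trans hz _; apply: rk_sub => x [[Sx Yx] zx]; split=> //.
  by apply/lall_rcons.
- by apply: rk_sub => x [Sx /lall_rcons [Yx zx]].
Qed.

Hypothesis t_gt0 : forall l, zeroO <o t l.

Lemma blocks_le_rk : \osum_(l : L) t l <=o rk v S.
Proof.
have h := @blocks_state _ [set: L] [::] (fun _ => False) zeroO erefl.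
apply: leO_trans (leO_trans (h _ _ _ _ _) _) => //.
  by rewrite addO0 [X in _ <=o X](eq_bigl xpredT) => [|l]; rewrite ?inE.
by apply: rk_sub => x [].
Qed.
End Blocks.

(** * Products of powers of omega *)

Lemma lall_cat (T : Type) (p : T -> Prop) s1 s2 : lall p (s1 ++ s2) <-> lall p s1 /\ lall p s2.
Proof. by elim: s1 => [|x s IH] /=; [split=> [|[]] | rewrite IH; split=> [[? []]|[[]]]]. Qed.

Lemma osum_lall_lt (T : Type) (s : seq T) (F : T -> On) u : closedO u -> zeroO <o u ->
  lall (fun y => F y <o u) s -> \osum_(y <- s) F y <o u.
Proof.
move=> cu u0; elim: s => [|y s IH] /=; first by rewrite big_nil.
by rewrite big_cons => -[Fy /IH]; apply: cu.
Qed.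

Lemma mulO_ltS t C : zeroO <o t -> mulO t C <o mulO t C.+1.
Proof. by move=> t0; rewrite -{1}(add0O (mulO t C)); apply: hadd_lt_l. Qed.

Section ProdPow.
Variables (I : finType) (B : I -> woset).
Local Notation X := (ProdW (fun i => Pow (B i))).
Local Notation exps := (forall i, B i).

(* [T b] is the product of the chains omega^(b i). *)
Definition T (b : exps) : X -> Prop := fun x => forall i, wo_lt (x i) (om (b i)).
Definition theta (b : exps) : On := rk (X := X) false (T b).

Definition lowers (b y : exps) : Prop :=
  exists i (b' : B i), wo_lt b' (b i) /\ y = dfwith b b'.

Lemma T_pzero b : T b (fun i => pzero (B i)).
Proof. by move=> i; apply: pzero_lt_om. Qed.

Lemma rkT_gt0 v b : zeroO <o rk v (T b).
Proof. exact: rk_gt0 (T_pzero b). Qed.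

Lemma lowers_wf : well_founded (fun y b => lowers b y).
Proof.
have /fin_all_exists [r hr] i : exists r : B i -> On, forall x y, wo_lt x y -> r x <o r y.
  exact: wf_rank (@wo_wf (B i)).
apply: (wf_incl _ _ _ _ (wf_inverse_image _ _ _ (fun b : exps => \osum_(i : I) r i (b i)) ltO_wf)).
move=> _ b [i [b' [hb ->]]]; apply: (osum_lt (i0 := i)) => [j|].
  case: (eqVneq i j) => [<-|ij]; first by rewrite dfwith_in; apply/ltO_leO/hr.
  by rewrite dfwith_out.
by rewrite dfwith_in; apply: hr.
Qed.

(** One list of lowered shapes bounds bad and antichain ranks alike, so it serves both for [theta]
    and for widths. Shapes may recur in it. *)
Definition covered (b : exps) (S : X -> Prop) : Prop :=
  exists2 s, lall (lowers b) s & forall v, rk v S <=o \osum_(y <- s) rk v (T y).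

Lemma covered_union b (S S1 S2 : X -> Prop) : (forall x, S x -> S1 x \/ S2 x) ->
  covered b S1 -> covered b S2 -> covered b S.
Proof.
move=> hS [s1 l1 r1] [s2 l2 r2]; exists (s1 ++ s2); first by apply/lall_cat.
move=> v; apply: leO_trans (rk_union v hS) _; rewrite big_cat.
by apply: hadd_mono.
Qed.

Lemma covered_empty b (S : X -> Prop) : (forall x, ~ S x) -> covered b S.
Proof. by move=> hS; exists [::] => // v; rewrite rk_empty. Qed.

Lemma covered_bigunion b (J : eqType) (s : seq J) (S : X -> Prop) (F : J -> X -> Prop) :
  (forall x, S x -> exists2 j, j \in s & F j x) -> (forall j, j \in s -> covered b (F j)) ->
  covered b S.
Proof.
elim: s S => [|j s IH] S hS hF; first by apply: covered_empty => x /hS [].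
apply: (@covered_union b S (F j) (fun x => exists2 k, k \in s & F k x)).
- move=> x /hS [k]; rewrite inE => /orP [/eqP ->|ks] Fk; [by left | by right; exists k].
- by apply: hF; rewrite inE eqxx.
- by apply: IH => // k ks; apply: hF; rewrite inE ks orbT.
Qed.

(** The normal form of [z] cuts the segment into finitely many powers omega^(e l), and z < omega^(b
    i) forces e l < b i. *)
Lemma covered_segment b i (z : Pow (B i)) : wo_lt z (om (b i)) ->
  covered b (fun x => T b x /\ wo_lt (x i) z).
Proof.
move=> zb; case: (classic (z = pzero (B i))) => [->|/dec_exists [N [e [pos [D _]]]]].
  by apply: covered_empty => x [_ /lt_pzero].
apply: (@covered_bigunion b nat (iota 0 N.+1) _
  (fun l x => T b x /\ wo_lt (x i) z /\ pos (x i) = l)).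
  by move=> x [Tx xz]; exists (pos (x i)); rewrite // mem_iota /= add0n ltnS (dec_pos D).
move=> l; rewrite mem_iota /= add0n ltnS => lN.
have eb : wo_lt (e l) (b i) by move/lt_om: zb; apply; apply: dec_supp D _ lN.
exists [:: dfwith b (e l)]; first by split=> //; exists i, (e l).
move=> v; rewrite big_seq1; have [h [h1 h2]] := dec_down D lN.
pose H := @dfwith I (fun j => Pow (B j) -> Pow (B j)) (fun j => id) i h.
apply: (@rk_coord _ _ v _ _ H).
  move=> x [Tx [xz xl]] j; rewrite /H; case: (eqVneq i j) => [<-|ij].
    by rewrite !dfwith_in; apply: h1.
  by rewrite !dfwith_out.
move=> x y j [Tx [xz xl]] [Ty [yz yl]] xy; rewrite /H.
case: (eqVneq i j) xy => [<-|ij] xy; first by rewrite !dfwith_in; apply: h2.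
by rewrite !dfwith_out.
Qed.

Lemma covered_res b z : T b z -> covered b (fun x => T b x /\ ~ prod_le z x).
Proof.
move=> Tz; apply: (@covered_bigunion b I (enum I) _ (fun i x => T b x /\ wo_lt (x i) (z i))).
  move=> x [Tx /not_all_ex_not [i /wo_lt_nge xz]].
  by exists i; rewrite ?mem_enum.
by move=> i _; apply: covered_segment.
Qed.

Lemma rk_res_cover v b z : T b z -> exists2 s, lall (lowers b) s &
  rk v (residual (@wqo_le X) v (T b) z) <=o \osum_(y <- s) rk v (T y).
Proof.
move=> /covered_res [s ls hs]; exists s => //; apply: leO_trans (hs v).
by apply: rk_sub => x [Tx [zx _]].
Qed.

Lemma lt_theta b c : c <o theta b -> exists2 s, lall (lowers b) s & c <=o \osum_(y <- s) theta y.
Proof.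
move=> /lt_rk [z Tz hc]; have [s ls hs] := rk_res_cover false Tz.
by exists s => //; apply: leO_trans hc hs.
Qed.

Lemma osum_lowers b s u : lall (lowers b) s -> zeroO <o u ->
  (forall i (b' : B i) C, wo_lt b' (b i) -> mulO (theta (dfwith b b')) C <=o u) ->
  \osum_(y <- s) theta y <o u.
Proof.
move=> ls u0 hu; case: s ls => [|y s] ls; first by rewrite big_nil.
(* The largest term bounds all others, so the sum is at most a multiple of it; one further copy
   makes the inequality strict. *)
suff [i [b' [hb h]]] : exists i (b' : B i), wo_lt b' (b i) /\
    \osum_(z <- y :: s) theta z <=o mulO (theta (dfwith b b')) (size (y :: s)).
  apply: leO_ltO_trans h _; apply: ltO_leO_trans (hu i b' _.+1 hb).
  by apply: mulO_ltS; apply: rkT_gt0.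
elim: s y ls => [|y' s IH] y [[i [b' [hb ey]]] ls].
  by exists i, b'; rewrite big_seq1 ey /mulO /= addO0.
have [i0 [b0 [hb0 h0]]] := IH y' ls; rewrite big_cons.
case: (leO_or_ltO (theta y) (theta (dfwith b b0))) => hy.
  by exists i0, b0; split=> //; apply: hadd_mono.
exists i, b'; split=> //; rewrite ey in hy *; apply: hadd_mono => //.
by apply: leO_trans h0 _; apply: mulO_mono; apply: ltO_leO.
Qed.

(** [M] adds up the [e]-coordinates of all earlier elements, with omega^c0 added to exceed each of
    them strictly; omega^c is closed under [padd]. *)
Lemma escape_bound e (c c0 : B e) Y : wo_lt c0 c ->
  lall (fun y : X => wo_lt (y e) (om c)) Y ->
  exists2 M, wo_lt M (om c) & lall (fun y : X => wo_lt (y e) M) Y.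
Proof.
move=> hb0; elim: Y => [_|y Y IH [Ty /IH [M hM MY]]].
  by exists (om c0); [apply: om_lt | ].
exists (padd M (padd (y e) (om c0))).
  by do 2!apply: padd_lt_om => //; apply: om_lt.
split.
  apply: wo_lt_le_trans (le_paddr _ _).
  by rewrite -{1}(padd0 (y e)); apply/padd_lt/pzero_lt_om.
by apply: lall_sub MY => x xM; apply: wo_lt_le_trans xM (le_padd _ _).
Qed.

Lemma shift_reflect (N x y : forall i, Pow (B i)) :
  prod_le (fun i => padd (N i) (x i)) (fun i => padd (N i) (y i)) -> prod_le x y.
Proof. by move=> h i; move: (h i) => /padd_le. Qed.

(* [C] translates of the factor omega^(b') fit below omega^(b i); for antichains,
   the unbounded coordinate [e] makes the translates quasi-incomparable. *)
Lemma stack v b i (b' : B i) t C : wo_lt b' (b i) -> closedO t -> zeroO <o t ->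
  t <=o rk v (T (dfwith b b')) ->
  (v -> exists2 e, e != i & exists b0, wo_lt b0 (b e)) ->
  mulO t C <=o rk v (T b).
Proof.
move=> hb ct t0 ht he; rewrite -mulO_osum.
(* In block [l], coordinate [i] runs from omega^b' * l up to, but excluding, omega^b' * (l+1). *)
pose Sl (l : 'I_C) (x : X) :=
  [/\ T b x, (x i).@b' = l & forall c, wo_lt b' c -> (x i).@c = 0].
apply: (@blocks_le_rk X v _ (fun k l : 'I_C => k <= l) (@nat_of_ord C) (fun _ => t) Sl (T b)) => //.
- by move=> k l kl nkl; rewrite ltn_neqAle kl andbT.
- by move=> l x [].
move=> Y l hY; apply: leO_trans ht _.
(* Block [l] receives the translate by [N]: omega^b' * l in coordinate [i] and, for antichains, the
   bound [M] in coordinate [e], which keeps every translate from lying below an earlier element. *)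
have [N [Ni Nb NY]] : exists N : forall j, Pow (B j),
    [/\ N i = mono b' l, forall j, i != j -> wo_lt (N j) (om (b j)) &
        v -> lall (fun y : X => exists j, wo_lt (y j) (N j)) Y].
  pose Z j := pzero (B j).
  case: (v) he => [/(_ isT) [e ei [b0 hb0]]|_]; last first.
    exists (dfwith Z (mono b' l)); split=> //; first by rewrite dfwith_in.
    by move=> j ij; rewrite dfwith_out //; apply: pzero_lt_om.
  have TY : lall (fun y : X => wo_lt (y e) (om (b e))) Y.
    by apply: lall_sub hY => y [k _ []].
  have [M hM MY] := escape_bound hb0 TY.
  exists (dfwith (dfwith Z M) (mono b' l)); split=> //; first by rewrite dfwith_in.
    move=> j ij; rewrite dfwith_out //; case: (eqVneq e j) => [<-|ej].
      by rewrite dfwith_in.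
    by rewrite dfwith_out //; apply: pzero_lt_om.
  move=> _; apply: lall_sub MY => y hy; exists e.
  by rewrite dfwith_out 1?eq_sym // dfwith_in.
apply: (@rk_map X X v _ _ (fun x j => padd (N j) (x j))); last first.
  by move=> x y _ _; apply: shift_reflect.
move=> x Tx; have xi : wo_lt (x i) (om b') by move: (Tx i); rewrite dfwith_in.
have hx : Sl l (fun j => padd (N j) (x j)).
  split.
  - move=> j; case: (eqVneq i j) => [<-|ij]; last first.
      by apply: padd_lt_om; [apply: Nb | move: (Tx j); rewrite dfwith_out].
    apply: padd_lt_om; last by apply: wo_trans xi (om_lt hb).
    rewrite Ni; apply/lt_om => c; case: (classic (c = b')) => [-> //|/mono_out -> //].
  - by change ((N i).@b' + (x i).@b' = l); rewrite Ni mono_at (lt_om_ge xi) ?addn0.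
  - move=> c b'c; change ((N i).@c + (x i).@c = 0); rewrite Ni mono_out.
      by rewrite (lt_om_ge xi) //; left.
    by move=> e; subst; apply: wo_irr b'c.
split=> //; apply/lall_In => y yY; split.
  have [k] := proj1 (lall_In _ _) hY y yY; rewrite -ltnNge => lk [Ty yk y0] /(_ i).
  apply/wo_lt_nge; have [_ hl h0] := hx.
  by exists b'; rewrite hl yk; split=> // c b'c; rewrite y0 // h0.
move=> hv hle; have [j hj] := proj1 (lall_In _ _) (NY hv) y yY.
have /wo_le_nlt := hle j; apply; exact: wo_lt_le_trans hj (le_padd _ _).
Qed.

(** Two ordinals below [theta b] are bounded by finite sums over lowered shapes. Their joint list is
    again such a sum, and [stack] fits any multiple of its largest term under [theta b]. *)
Lemma theta_closed b : closedO (theta b).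
Proof.
elim/(well_founded_ind lowers_wf): b => b IH a a' /lt_theta [s ls hs] /lt_theta [s' ls' hs'].
apply: leO_ltO_trans (hadd_mono hs hs') _.
rewrite -(big_cat _ s s' xpredT) /=; apply: (osum_lowers (b := b)).
- by apply/lall_cat.
- exact: rkT_gt0.
move=> i b' C hb; apply: stack (hb) _ _ _ _ => //; last exact: rkT_gt0.
by apply: IH; exists i, b'.
Qed.

Lemma theta_mono b b' : (forall i, wo_le (b i) (b' i)) -> theta b <=o theta b'.
Proof.
move=> hb; apply: rk_sub => x Tx i; apply: wo_lt_le_trans (Tx i) (om_le (hb i)).
Qed.

Lemma theta_lt b i (b' : B i) : wo_lt b' (b i) -> theta (dfwith b b') <o theta b.
Proof.
move=> hb; have t0 := rkT_gt0 false (dfwith b b').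
apply: ltO_leO_trans (_ : mulO _ 2 <=o _); last first.
  by apply: stack (hb) (@theta_closed (dfwith b b')) t0 _ _.
by rewrite -{1}(addO0 (theta _)); apply: hadd_lt_r; rewrite /mulO /= addO0.
Qed.

(* Two nonzero exponents guarantee an escape coordinate for every application of [stack]. *)
Lemma theta_le_shift (sh : forall i, B i -> B i) j1 j2 : j1 != j2 ->
  (forall i b b', wo_lt b b' -> wo_lt (sh i b) (sh i b')) ->
  (forall b, exists b0, wo_lt b0 (sh j1 b)) -> (forall b, exists b0, wo_lt b0 (sh j2 b)) ->
  forall b, theta b <=o rk true (T (fun i => sh i (b i))).
Proof.
move=> j12 shm sh1 sh2 b; elim/(well_founded_ind lowers_wf): b => b IH.
apply: leO_from_lt => c /lt_theta [s ls hs]; apply: leO_ltO_trans hs _.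
apply: (osum_lowers (b := b)) => //; first exact: rkT_gt0.
move=> i b' C hb; apply: (@stack true _ i (sh i b')); first exact: shm.
- exact: theta_closed.
- exact: rkT_gt0.
- have := IH (dfwith b b'); have -> : (fun j => sh j (dfwith b b' j)) =
      dfwith (fun j => sh j (b j)) (sh i b').
    apply: functional_extensionality_dep => j; case: (eqVneq i j) => [<-|ij].
      by rewrite !dfwith_in.
    by rewrite !dfwith_out.
  by apply; exists i, b'.
move=> _; case: (eqVneq j1 i) => [e|]; last by exists j1.
by exists j2; rewrite // eq_sym -e.
Qed.
End ProdPow.

(** * Exponents with a finite and an infinite part *)

Section Nsum.
Variable C : woset.

(** The order type omega + C: as exponents, the [inl] are finite and the [inr] infinite, so the
    constructor tells them apart. *)
Definition nsum_lt (x y : nat + C) : Prop :=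
  match x, y with
  | inl p, inl q => p < q
  | inl _, inr _ => True
  | inr _, inl _ => False
  | inr c, inr d => wo_lt c d
  end.

Lemma nsum_irr x : ~ nsum_lt x x.
Proof. by case: x => [p|c] /=; [rewrite ltnn | apply: wo_irr]. Qed.

Lemma nsum_trans x y z : nsum_lt x y -> nsum_lt y z -> nsum_lt x z.
Proof. by case: x y z => [p|c] [q|d] [r|e] //=; [apply: ltn_trans | apply: wo_trans]. Qed.

Lemma nsum_total x y : nsum_lt x y \/ x = y \/ nsum_lt y x.
Proof.
case: x y => [p|c] [q|d] /=; [|by left|by right; right|].
  by case: (ltngtP p q) => [||->]; [left | right; right | right; left].
by case: (wo_total c d) => [|[->|]]; [left | right; left | right; right].
Qed.

Lemma nsum_wf : well_founded nsum_lt.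
Proof.
have accl p : Acc nsum_lt (inl p).
  elim/ltn_ind: p => p IH; constructor=> -[q|//] /= /IH //.
move=> [p|c]; first exact: accl.
elim/(well_founded_ind (@wo_wf C)): c => c IH.
by constructor=> -[q _|d dc]; [apply: accl | apply: IH].
Qed.

Definition nsum : woset := WOSet nsum_irr nsum_trans nsum_total nsum_wf.

Definition fin_exp (x : nsum) : Prop := exists q, x = inl q.

Definition fin_val (x : nsum) : nat := match x with inl q => q | inr _ => 0 end.

(** Addition of 1 on the left: never 0, and the identity on infinite exponents. *)
Definition one_plus (x : nsum) : nsum := match x with inl q => inl q.+1 | inr c => inr c end.

Lemma one_plus_mono (x y : nsum) : wo_lt x y -> wo_lt (one_plus x) (one_plus y).
Proof. by case: x y => [p|c] [q|d] h; exact: h. Qed.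

Lemma one_plus_gt0 (x : nsum) : exists x0 : nsum, wo_lt x0 (one_plus x).
Proof. by exists (inl 0); case: x. Qed.

Lemma nsum0_le (x : nsum) : wo_le (inl 0 : nsum) x.
Proof.
apply/wo_le_nlt; case: x => [p|c] h; last exact: h.
by have : p < 0 by exact: h.
Qed.

Lemma nsum_gt0 (x : nsum) : x <> inl 0 -> wo_lt (inl 0 : nsum) x.
Proof. by move=> h; case: (nsum0_le x) => // e; case: h. Qed.

Lemma lt_om0 (g : Pow nsum) : wo_lt g (om (inl 0 : nsum)) -> g = pzero nsum.
Proof.
move=> /lt_om h; apply: pow_supp_zero => -[x /h]; move/wo_lt_nge; apply; exact: nsum0_le.
Qed.
End Nsum.

Section OneInfiniteExponent.
Variables (I : finType) (C : I -> woset) (j0 : I).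
Local Notation B := (fun i => nsum (C i)).
Local Notation X := (ProdW (fun i => Pow (B i))).
Local Notation exps := (forall i, B i).
Implicit Types (b y : exps).

Definition degree b : nat := \sum_(i | i != j0) fin_val (b i).

Definition only (beta : B j0) : exps := dfwith (fun i => inl 0 : B i) beta.

(* The exponents at coordinates other than [j0] will be finite; [tower p beta] is then
   omega^(beta + p), where [p] is their sum and [beta] the exponent at [j0]. *)
Definition tower (p : nat) (beta : B j0) : On := iter p omegaO (theta (only beta)).

Lemma tower_closed p beta : closedO (tower p beta).
Proof. by case: p => [|p]; [apply: theta_closed | apply: omegaO_closed]. Qed.

Lemma tower_gt0 p beta : zeroO <o tower p beta.
Proof.
case: p => [|p]; first exact: rkT_gt0.
exact: leO_ltO_trans (lt_omegaO _).
Qed.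

Lemma tower_lt_p p q beta : p < q -> tower p beta <o tower q beta.
Proof.
elim: q => // q IH; rewrite ltnS leq_eqVlt => /orP [/eqP ->|/IH h]; first exact: lt_omegaO.
exact: ltO_trans h (lt_omegaO _).
Qed.

Lemma tower_lt_beta p beta beta' : wo_lt beta' beta -> tower p beta' <o tower p beta.
Proof.
move=> h; elim: p => [|p IH].
  have hb : wo_lt beta' (only beta j0) by rewrite /only dfwith_in.
  have := theta_lt hb; suff -> : dfwith (only beta) beta' = only beta' by [].
  apply: functional_extensionality_dep => j; rewrite /only; case: (eqVneq j0 j) => [<-|ij].
    by rewrite !dfwith_in.
  by rewrite !dfwith_out.
apply: leO_ltO_trans (lt_omegaO (tower p beta)); apply/osup_le => c.
exact: closedO_mulO (@tower_closed p beta) IH.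
Qed.

Lemma one_le_tower p beta : oneO <=o tower p beta.
Proof. by apply/le1O; apply: tower_gt0. Qed.

Lemma one_lt_tower p (beta : B j0) : 0 < p \/ beta <> inl 0 -> oneO <o tower p beta.
Proof.
case=> [p0|/nsum_gt0 b0].
  by apply: leO_ltO_trans (tower_lt_p beta p0); apply: (one_le_tower 0).
by apply: leO_ltO_trans (tower_lt_beta p b0); apply: one_le_tower.
Qed.

Lemma degree_dfwith b i (x : B i) : i != j0 ->
  degree (dfwith b x) + fin_val (b i) = degree b + fin_val x.
Proof.
move=> ij; rewrite /degree (bigD1 i) //= [in RHS](bigD1 i) //= dfwith_in.
under eq_bigr => k /andP [_ ki] do rewrite dfwith_out 1?eq_sym //.
by rewrite [LHS]addnC -[RHS]addnA; congr addn; rewrite addnC.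
Qed.

Lemma degree_dfwith_j0 b (x : B j0) : degree (dfwith b x) = degree b.
Proof. by apply: eq_bigr => i ij; rewrite dfwith_out 1?eq_sym. Qed.

Lemma degree0 b : (forall i, i != j0 -> fin_exp (b i)) -> degree b = 0 -> b = only (b j0).
Proof.
move=> hf hd; apply: functional_extensionality_dep => i; rewrite /only.
case: (eqVneq j0 i) => [<-|ij]; first by rewrite dfwith_in.
rewrite dfwith_out //; rewrite eq_sym in ij; have [q e] := hf i ij.
move/eqP: hd; rewrite /degree sum_nat_eq0 => /forallP /(_ i).
by rewrite ij e /= => /eqP ->.
Qed.

Lemma fin_dfwith b i (x : B i) : (i != j0 -> fin_exp x) ->
  (forall k, k != j0 -> fin_exp (b k)) -> forall k, k != j0 -> fin_exp (dfwith b x k).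
Proof.
move=> hx hb k kj; case: (eqVneq i k) kj => [<-|ik] kj; first by rewrite dfwith_in; apply: hx.
by rewrite dfwith_out //; apply: hb.
Qed.

(** Lowering a finite exponent by 1 lowers the degree by 1, and [stack] fits all finite multiples of
    the smaller rank: each unit of degree contributes a factor omega. *)
Lemma tower_le_theta b : (forall i, i != j0 -> fin_exp (b i)) ->
  tower (degree b) (b j0) <=o theta b.
Proof.
move E: (degree b) => p; elim: p b E => [|p IH] b hp hf.
  by rewrite /tower /= -degree0.
have [i ij hi] : exists2 i, i != j0 & fin_val (b i) != 0.
  apply: NNPP => h; suff : degree b = 0 by rewrite hp.
  apply: big1 => i ij; apply/eqP; apply: contraT => bi; by case: h; exists i.
have [q e] := hf i ij; case: q e => [|q] e; first by rewrite e in hi.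
have hb : wo_lt (inl q : B i) (b i) by rewrite e /=.
have hd := degree_dfwith b (inl q : B i) ij.
rewrite hp e /= addSn addnS in hd; case: hd => /addIn hd.
have := IH _ hd (fin_dfwith (fun _ => ex_intro _ q erefl) hf).
rewrite dfwith_out // => hle; apply/osup_le => c.
apply: ltO_leO_trans (_ : mulO (theta (dfwith b (inl q : B i))) c.+1 <=o _).
  apply: ltO_leO_trans (mulO_mono c.+1 hle).
  by apply: mulO_ltS; apply: tower_gt0.
by apply: (@stack I B false b i _ _ c.+1 hb (@theta_closed I B _) (rkT_gt0 false _)).
Qed.

Lemma rk_chain v i0 b : (forall i, i != i0 -> b i = inl 0) -> (v : bool) -> rk v (T b) <=o oneO.
Proof.
move=> hb hv; apply/rk_le => z Tz; rewrite rk_empty; first by apply/le1O.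
move=> x [Tx [zx /(_ hv) xz]].
have eqo i : i != i0 -> x i = z i.
  move=> ii; move: (Tx i) (Tz i); rewrite hb // => /lt_om0 -> /lt_om0 -> //.
case: (wo_le_or_lt (z i0) (x i0)) => h.
  by apply: zx => i; case: (eqVneq i i0) => [->|/eqo ->].
by apply: xz => i; case: (eqVneq i i0) => [->|/eqo ->] //; left.
Qed.

(** Lowering an exponent strictly lowers the tower, and the tower is closed, so the finite cover of
    a residual stays below it. The factor omega is lost at the start of the induction, where the
    product is a chain of width 1. *)
Lemma rk_anti_le_tower b : (forall i, i != j0 -> fin_exp (b i)) -> 0 < degree b ->
  rk true (T b) <=o tower (degree b).-1 (b j0).
Proof.
elim/(well_founded_ind (@lowers_wf I B)): b => b IH hf hd.
(* Here the tower is only 1, and lowering the last unit of degree leaves a chain, whose width bound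
   1 is not smaller; this case is settled directly. *)
case: (classic (degree b = 1 /\ b j0 = inl 0)) => [[d1 b0]|hn].
  apply: leO_trans (one_le_tower _ _).
  have [i ij hi] : exists2 i, i != j0 & fin_val (b i) != 0.
    apply: NNPP => h; suff : degree b = 0 by rewrite d1.
    apply: big1 => i ij; apply/eqP; apply: contraT => bi; by case: h; exists i.
  apply: (rk_chain (i0 := i)) => // k ki.
  case: (eqVneq k j0) => [->|kj]; first exact: b0.
  have [q e] := hf k kj; rewrite e; congr inl.
  move: d1; rewrite /degree (bigD1 i) //= (bigD1 k) /= ?kj // e /=.
  by case: (fin_val (b i)) hi => // m _; case: q {e} => // q; rewrite addSn addnS.
apply/rk_le => z Tz; have [s ls hs] := rk_res_cover true Tz.
apply: leO_ltO_trans hs _; apply: osum_lall_lt; [exact: tower_closed | exact: tower_gt0 |].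
apply: lall_sub ls => y hy; have IHy := IH y hy; case: hy => i [b' [hb ey]]; subst y.
case: (eqVneq i j0) => [e|ij].
  subst i; rewrite degree_dfwith_j0 dfwith_in in IHy.
  apply: leO_ltO_trans (IHy _ hd) (tower_lt_beta _ hb).
  by apply: fin_dfwith => //; rewrite eqxx.
have [q e] := hf i ij; case: b' hb IHy => [q'|d]; rewrite e /= => q'q IHy; last by case: q'q.
  have hf' := fin_dfwith (fun _ : i != j0 => ex_intro _ q' erefl : fin_exp (inl q' : B i)) hf.
  have := degree_dfwith b (inl q' : B i) ij; rewrite e /= => hdeg.
  have lt_deg : degree (dfwith b (inl q' : B i)) < degree b.
    by rewrite -(ltn_add2r q) hdeg ltn_add2l.
  rewrite dfwith_out // in IHy.
  case: (posnP (degree (dfwith b (inl q' : B i)))) => [d0|dpos].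
    apply: leO_ltO_trans (_ : oneO <o _).
      apply: (rk_chain (i0 := j0)) => // k kj.
      by rewrite (degree0 hf' d0) /only dfwith_out // eq_sym.
    apply: one_lt_tower; case: (classic (b j0 = inl 0)) => b0; [left | by right].
    by rewrite ltnNge leqn0 -subn1 subn_eq0; apply/negP => d1; apply: hn; split=> //; apply/eqP; rewrite eqn_leq d1.
  apply: leO_ltO_trans (IHy hf' dpos) _; apply: tower_lt_p.
  by rewrite -ltnS !prednK.
Qed.

Lemma rk_anti_lt_theta b : (forall i, i != j0 -> fin_exp (b i)) ->
  (exists i, b i <> inl 0) -> rk true (T b) <o theta b.
Proof.
move=> hf [i bi]; apply: ltO_leO_trans (tower_le_theta hf).
case: (posnP (degree b)) => [d0|dpos].
  have eb := degree0 hf d0.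
  apply: leO_ltO_trans (_ : oneO <o _).
    by apply: (rk_chain (i0 := j0)) => // k kj; rewrite eb /only dfwith_out // eq_sym.
  apply: one_lt_tower; right => e; apply: bi; rewrite eb /only e.
  by case: (eqVneq j0 i) => [<-|ij]; rewrite ?dfwith_in // dfwith_out.
apply: leO_ltO_trans (rk_anti_le_tower hf dpos) _.
by apply: tower_lt_p; rewrite prednK.
Qed.
End OneInfiniteExponent.

(** * Block decomposition of products of ordinals *)

Section BlockDecomposition.
Variables (I : finType) (B : I -> woset).
Local Notation X := (ProdW (fun i => Pow (B i))).
Variables (f : forall i, Pow (B i)) (N : I -> nat).
Variables (e : forall i, nat -> B i) (pos : forall i, Pow (B i) -> nat).
Hypothesis D : forall i, Dec (f i) (N i) (e i) (@pos i).

Definition Z : X -> Prop := fun x => forall i, wo_lt (x i) (f i).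

Definition block_index : finType := {dffun forall i, 'I_(N i).+1}.

Implicit Types k l : block_index.

Definition block l : X -> Prop := fun x => Z x /\ forall i, pos (x i) = l i.

Definition block_exps l : forall i, B i := fun i => e i (l i).

Lemma in_block x : Z x -> exists l, block l x.
Proof.
move=> Zx; exists [ffun i => inord (pos (x i))]; split=> // i.
by rewrite ffunE inordK // ltnS (dec_pos (D i)).
Qed.

Lemma rk_block_le v l : rk v (block l) <=o rk v (T (block_exps l)).
Proof.
have /fin_all_exists [h hh] i := dec_down (D i) (ltn_ord (l i) : l i <= N i).
apply: (@rk_coord _ _ v _ _ h).
  by move=> x [Zx px] i; have [h1 _] := hh i; apply: h1.
by move=> x y i [Zx px] [Zy py]; have [_ h2] := hh i; apply: h2.
Qed.

Lemma rk_Z_le v (P : pred block_index) (S : X -> Prop) :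
  (forall x, S x -> Z x) -> (forall x l, S x -> block l x -> P l) ->
  rk v S <=o \osum_(l | P l) rk v (T (block_exps l)).
Proof.
move=> SZ SP; apply: leO_trans (osum_mono _ (fun l _ => rk_block_le v l)).
apply: rk_bigunion => x Sx; have [l bl] := in_block (SZ x Sx).
by exists l => //; apply: SP bl.
Qed.

(** Blocks are compared by their index vectors, with the sum of indices as height; exponents weakly
    decrease along a normal form, so the ranks are antitone. For antichains, coordinate [i0]
    consists of one block, so climbing along it never changes the block. *)
Lemma osum_theta_le (v : bool) :
  (v -> exists i0 c c0, [/\ f i0 = om c, N i0 = 0 & wo_lt c0 c]) ->
  (forall l, theta (block_exps l) <=o rk v (T (block_exps l))) ->
  \osum_(l : block_index) theta (block_exps l) <=o rk v Z.
Proof.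
move=> hv ht; pose leL k l := [forall i, k i <= l i].
apply: (@blocks_le_rk X v _ leL (fun l => \sum_i l i) _ block).
- move=> k l /forallP kl nkl.
  have [i ki] : exists i, k i != l i.
    apply/existsP; rewrite -negb_forall; apply: contraNN nkl => /forallP h.
    by apply/eqP/ffunP => i; apply/eqP.
  rewrite (bigD1 i) //= [X in _ < X](bigD1 i) //= -addSn leq_add ?leq_sum //.
  by rewrite ltn_neqAle kl andbT.
- by move=> k l /forallP kl; apply: theta_mono => i; apply: dec_anti (D i) _ _ _ _; rewrite // -ltnS.
- by move=> l; apply: theta_closed.
- by move=> l x [].
- move=> Y l hY; apply: leO_trans (ht l) _.
  have [M [Mf M0 MY]] : exists M : forall i, Pow (B i),
      [/\ forall i g, wo_lt g (f i) -> wo_lt (padd (M i) g) (f i),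
          forall i g, pos g = l i -> wo_lt g (f i) -> pos (padd (M i) g) = l i &
          v -> lall (fun y : X => exists j, wo_lt (y j) (M j)) Y].
    pose O i := pzero (B i); have padd0l i g : padd (O i) g = g by rewrite paddC padd0.
    case: (v) hv => [/(_ isT) [i0 [c [c0 [fc Nc cc]]]]|_]; last first.
      by exists O; split=> // i g; rewrite padd0l.
    have [|M hM MY] := @escape_bound _ _ i0 c c0 Y cc.
      by apply: lall_sub hY => y [k _ [Zy _]]; rewrite -fc.
    have Mf g : wo_lt g (f i0) -> wo_lt (padd M g) (f i0).
      by rewrite fc; apply: padd_lt_om.
    exists (dfwith O M); split=> [i g|i g|_].
    + case: (eqVneq i0 i) g => [<-|ii] g; first by rewrite dfwith_in; apply: Mf.
      by rewrite dfwith_out // padd0l.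
    + case: (eqVneq i0 i) g => [<-|ii] g; last by rewrite dfwith_out // padd0l.
      have le0 a : a <= N i0 -> a = 0 by rewrite Nc leqn0 => /eqP.
      rewrite dfwith_in => _ /Mf /(dec_pos (D i0)) /le0 ->.
      by rewrite (le0 (l i0)) // -ltnS.
    + by apply: lall_sub MY => y hy; exists i0; rewrite dfwith_in.
  have /fin_all_exists [h hh] i := dec_up (D i) (ltn_ord (l i) : l i <= N i).
  apply: (@rk_coord _ _ v _ _ (fun i g => padd (M i) (h i g))).
    move=> x Tx; have hx : block l (fun i => padd (M i) (h i (x i))).
      split=> i; have [h1 _] := hh i; have [h1f h1p] := h1 _ (Tx i); first exact: Mf.
      exact: M0.
    split=> //; apply/lall_In => y yY; split.
      have [k] := proj1 (lall_In _ _) hY y yY; rewrite negb_forall => /existsP [i].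
      rewrite -ltnNge => lk [Zy py] /(_ i) hle; have [Zx px] := hx.
      by move: (dec_mono (D i) hle (Zx i)); rewrite py px leqNgt lk.
    move=> vt hle; have [j hj] := proj1 (lall_In _ _) (MY vt) y yY.
    have /wo_le_nlt := hle j; apply; exact: wo_lt_le_trans hj (le_padd _ _).
  by move=> x y i Tx Ty xy; have [_ h2] := hh i; apply/padd_lt/h2.
- by move=> l; apply: rkT_gt0.
Qed.

Lemma rk_bad_Z : rk false Z = \osum_(l : block_index) theta (block_exps l).
Proof. by apply: leO_anti; [apply: rk_Z_le | apply: osum_theta_le]. Qed.

Lemma rk_anti_eq_bad_Z :
  (exists i0 c c0, [/\ f i0 = om c, N i0 = 0 & wo_lt c0 c]) ->
  (forall l, theta (block_exps l) <=o rk true (T (block_exps l))) ->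
  rk true Z = rk false Z.
Proof.
move=> hi ht; apply: leO_anti; first exact: rk_anti_bad.
by rewrite rk_bad_Z; apply: osum_theta_le.
Qed.

Lemma rk_anti_lt_bad_block l :
  rk true (T (block_exps l)) <o theta (block_exps l) -> rk true Z <o rk false Z.
Proof.
move=> hl; rewrite rk_bad_Z; apply: leO_ltO_trans (@rk_Z_le true xpredT Z _ _) _ => //.
by apply: (osum_lt (i0 := l)) => // k; apply: rk_anti_bad.
Qed.

(** Dropping either block removes a positive term from the natural sum, and an antichain cannot use
    both. *)
Lemma rk_anti_lt_bad_low_high lo hi : lo != hi ->
  (forall x y, block lo x -> block hi y -> prod_le x y) -> rk true Z <o rk false Z.
Proof.
move=> neq lohi; rewrite rk_bad_Z.
have bound k : rk true (fun x => Z x /\ ~ block k x) <o \osum_(l : block_index) theta (block_exps l).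
  apply: leO_ltO_trans (rk_anti_bad _) _.
  apply: leO_ltO_trans (@rk_Z_le false (fun l => l != k) _ _ _) _ => [x []|x l [Zx nk] bl|].
  - by [].
  - by apply/eqP => ek; subst.
  - by apply: osum_drop_lt; apply: rkT_gt0.
have disj x : block lo x -> ~ block hi x.
  move=> [_ h1] [_ h2]; move/eqP: neq; apply; apply/ffunP => i; apply: ord_inj.
  by rewrite -h1 -h2.
case: (leO_or_ltO (rk true (fun x => Z x /\ ~ block lo x)) (rk true (fun x => Z x /\ ~ block hi x))) => h.
  by apply: leO_ltO_trans (bound hi); apply: (rk_anti_low_high (lo := block lo) (hi := block hi)).
apply: leO_ltO_trans (bound lo); apply: (rk_anti_low_high (lo := block lo) (hi := block hi)) => //.
exact: ltO_leO.
Qed.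
End BlockDecomposition.

(** * Well-orders as initial segments of powers of omega *)

(** Mostowski-style collapse: [F x] is the least value above all earlier ones and exists because
    [g0 x] is such a bound. [f] is the least point outside the image; [u] shows that there is
    one. *)
Lemma wo_collapse (A W : woset) (g0 : A -> W) (u : W) :
  (forall x y, wo_lt x y -> wo_lt (g0 x) (g0 y)) -> (forall x, wo_lt (g0 x) u) ->
  exists (f : W) (F : A -> W), (forall x y, wo_lt x y -> wo_lt (F x) (F y)) /\
    forall g, wo_lt g f <-> exists x, g = F x.
Proof.
move=> g0m g0u.
pose bnd x (rec : forall y : A, wo_lt y x -> W) (g : W) := forall y h, wo_lt (rec y h) g.
pose F := Fix (@wo_wf A) (fun _ => W) (fun x rec => epsilon (inhabits u)
  (fun g => bnd x rec g /\ forall g', bnd x rec g' -> wo_le g g')).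
have FE x : F x = epsilon (inhabits u) (fun g => bnd x (fun y _ => F y) g /\
    forall g', bnd x (fun y _ => F y) g' -> wo_le g g').
  rewrite {1}/F Fix_eq // => z f g fg.
  have -> // : f = g.
  by do 2 (apply: functional_extensionality_dep => ?).
have Fspec x : (forall y, wo_lt y x -> wo_lt (F y) (F x)) /\
    (forall g, (forall y, wo_lt y x -> wo_lt (F y) g) -> wo_le (F x) g) /\ wo_le (F x) (g0 x).
  elim/(well_founded_ind (@wo_wf A)): x => x IH.
  have b0 : bnd x (fun y _ => F y) (g0 x).
    by move=> y yx; have [_ [_ h]] := IH y yx; apply: wo_le_lt_trans h (g0m _ _ yx).
  have [m hm mmin] := @wo_least W (bnd x (fun y _ => F y)) (ex_intro _ _ b0).
  have [h1 h2] := epsilon_spec (inhabits u) (fun g => bnd x (fun y _ => F y) g /\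
    forall g', bnd x (fun y _ => F y) g' -> wo_le g g') (ex_intro _ m (conj hm mmin)).
  by rewrite FE; split=> //; split=> [g hg|]; apply: h2.
have Fm x y : wo_lt x y -> wo_lt (F x) (F y) by move=> xy; apply: (proj1 (Fspec y)).
have Fdown x g : wo_lt g (F x) -> exists y, g = F y.
  elim/(well_founded_ind (@wo_wf A)): x g => x IH g gx.
  have [y hy] : exists y, ~ (wo_lt y x -> wo_lt (F y) g).
    apply: not_all_ex_not => h; have [_ [h2 _]] := Fspec x.
    by move/wo_lt_nge: gx; apply; apply: h2.
  have [yx /wo_le_nlt [gy|->]] := imply_to_and _ _ hy; last by exists y.
  exact: IH gy.
have [f hf fmin] := @wo_least W (fun g => ~ exists x, g = F x) (ex_intro _ u (fun ex =>
  let: ex_intro x e := ex in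
  @wo_irr W u (eq_ind_r (fun z => wo_lt z u) (wo_le_lt_trans (proj2 (proj2 (Fspec x))) (g0u x)) e))).
exists f, F; split=> // g; split=> [gf|[x ->]].
  by apply: NNPP => hn; move/wo_lt_nge: gf; apply; apply: fmin.
apply/wo_lt_nge => -[h|e]; last by apply: hf; exists x.
exact: hf (Fdown _ _ h).
Qed.

Section WithTop.
Variable A : woset.

Definition top_lt (x y : option A) : Prop :=
  match x, y with
  | Some a, Some b => wo_lt a b
  | Some _, None => True
  | None, _ => False
  end.

Lemma top_irr x : ~ top_lt x x.
Proof. by case: x => [a|] //=; apply: wo_irr. Qed.

Lemma top_trans x y z : top_lt x y -> top_lt y z -> top_lt x z.
Proof. by case: x y z => [a|] [b|] [c|] //=; apply: wo_trans. Qed.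

Lemma top_total x y : top_lt x y \/ x = y \/ top_lt y x.
Proof.
case: x y => [a|] [b|] /=; [|by left|by right; right|by right; left].
by case: (wo_total a b) => [|[->|]]; [left | right; left | right; right].
Qed.

Lemma top_wf : well_founded top_lt.
Proof.
have acc a : Acc top_lt (Some a).
  elim/(well_founded_ind (@wo_wf A)): a => a IH.
  by constructor=> -[b ba|[]]; apply: IH.
by case=> [a|]; [apply: acc | constructor=> -[b _|[]]; apply: acc].
Qed.

Definition with_top : woset := WOSet top_irr top_trans top_total top_wf.

(** An ordinal is at most its own power of omega: exponents come from [A] itself, and the added top
    bounds the embedding a -> omega^(omega + a). *)
Lemma embed_pow : exists (f : Pow (nsum with_top)) (F : A -> Pow (nsum with_top)),
  (forall x y, wo_lt x y -> wo_lt (F x) (F y)) /\ forall g, wo_lt g f <-> exists x, g = F x.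
Proof.
apply: (@wo_collapse A _ (fun a => om (inr (Some a) : nsum with_top)) (om (inr None : nsum with_top))).
  by move=> x y xy; apply: om_lt.
by move=> x; apply: om_lt.
Qed.
End WithTop.

Lemma natw_irr x : ~ nat_lt x x.
Proof. by rewrite /nat_lt ltnn. Qed.

Lemma natw_trans x y z : nat_lt x y -> nat_lt y z -> nat_lt x z.
Proof. exact: ltn_trans. Qed.

Lemma natw_total x y : nat_lt x y \/ x = y \/ nat_lt y x.
Proof. by rewrite /nat_lt; case: (ltngtP x y) => [||->]; [left | right; right | right; left]. Qed.

Lemma natw_wf : well_founded nat_lt.
Proof. by move=> p; elim/ltn_ind: p => p IH; constructor=> q /IH. Qed.

Definition natw : woset := WOSet natw_irr natw_trans natw_total natw_wf.

Section Segment.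
Variables (W : woset) (b : W).

Definition seg_lt (x y : {x : W | wo_lt x b}) : Prop := wo_lt (proj1_sig x) (proj1_sig y).

Lemma seg_irr x : ~ seg_lt x x.
Proof. exact: wo_irr. Qed.

Lemma seg_trans x y z : seg_lt x y -> seg_lt y z -> seg_lt x z.
Proof. exact: wo_trans. Qed.

Lemma seg_total x y : seg_lt x y \/ x = y \/ seg_lt y x.
Proof.
case: (wo_total (proj1_sig x) (proj1_sig y)) => [|[e|]]; [by left | | by right; right].
by right; left; apply: sig_eq.
Qed.

Lemma seg_wf : well_founded seg_lt.
Proof. exact: (wf_inverse_image _ _ _ (@proj1_sig W _) (@wo_wf W)). Qed.

Definition seg : woset := WOSet seg_irr seg_trans seg_total seg_wf.
End Segment.

Lemma fun_choice (T : Type) (U : T -> Type) (R : forall x, U x -> Prop) :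
  (forall x, exists y, R x y) -> exists g : forall x, U x, forall x, R x (g x).
Proof.
move=> h; exists (fun x => proj1_sig (constructive_indefinite_description _ (h x))) => x.
by case: constructive_indefinite_description.
Qed.

Lemma order_iso_surj (W : woset) (U : Type) (ltU : U -> U -> Prop) (phi : W -> U) :
  (forall u, ~ ltU u u) -> (forall x y, wo_lt x y <-> ltU (phi x) (phi y)) ->
  (forall u, exists x, phi x = u) -> order_iso (@wo_lt W) ltU.
Proof.
move=> irr hphi surj.
have inj x y : phi x = phi y -> x = y.
  move=> e; case: (wo_total x y) => [/hphi|[//|/hphi]]; rewrite e => /irr //.
have [g gK] := fun_choice surj.
by exists phi, g; split=> [x|]; [apply: inj; rewrite gK | split=> // u; rewrite gK].
Qed.

(** * Restricting and splitting the set of exponents *)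

Section Pull.
Variables (B D : Type) (iota : D -> B).
Hypothesis iota_inj : forall x y, iota x = iota y -> x = y.

Lemma pull_supp (p : B -> nat) : fin_supp p -> fin_supp (fun d => p (iota d)).
Proof.
move=> [l hl].
have [l' hl'] : exists l' : list D, forall d, List.In (iota d) l -> List.In d l'.
  elim: l {hl} => [|b l [l' IH]]; first by exists [::].
  case: (classic (exists d, iota d = b)) => [[d <-]|h].
    by exists (d :: l') => d' [/iota_inj ->|/IH]; [left | right].
  by exists l' => d [e|/IH //]; case: h; exists d.
by exists l' => d /hl /hl'.
Qed.
End Pull.

Definition pull (B D : Type) (iota : D -> B) (inj : forall x y, iota x = iota y -> x = y)
  (f : omega_pow_car B) : omega_pow_car D := exist _ _ (pull_supp inj (proj2_sig f)).

Definition exp_sub (B : woset) (b : B) (g : Pow B) : Pow (seg b) :=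
  @pull B (seg b) (@proj1_sig B _) (fun x y e => sig_eq e) g.

Lemma exp_sub_lt (B : woset) (b : B) (g g' : Pow B) :
  wo_lt g (om b) -> wo_lt g' (om b) -> (wo_lt g g' <-> wo_lt (exp_sub b g) (exp_sub b g')).
Proof.
move=> gb g'b; split=> -[x [gx hx]].
  have xb : wo_lt x b by move/lt_om: g'b; apply => e; rewrite e in gx.
  by exists (exist _ x xb); split=> // -[y yb] xy; apply: hx.
exists (proj1_sig x); split=> // y xy; case: (wo_le_or_lt b y) => yb.
  by rewrite (lt_om_ge gb yb) (lt_om_ge g'b yb).
exact: (hx (exist _ y yb)).
Qed.

Lemma exp_sub_surj (B : woset) (b : B) (h : Pow (seg b)) :
  exists2 g : Pow B, wo_lt g (om b) & exp_sub b g = h.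
Proof.
pose p (x : B) := match excluded_middle_informative (wo_lt x b) with
  | left xb => h.@(exist _ x xb) | right _ => 0 end.
have supp : fin_supp p.
  have [l hl] := proj2_sig h; exists (List.map (@proj1_sig B _) l) => x.
  rewrite /p; case: excluded_middle_informative => // xb /hl xl.
  exact: (List.in_map (@proj1_sig B _) _ _ xl).
exists (exist _ p supp).
  by apply/lt_om => x; rewrite /= /p; case: excluded_middle_informative.
apply: pow_eq => -[x xb]; rewrite /= /p; case: excluded_middle_informative => // xb'.
by congr (h.@_); apply: sig_eq.
Qed.

Section SplitNsum.
Variable C : woset.

Lemma inl_inj (x y : nat) : inl x = inl y :> nat + C -> x = y.
Proof. by case. Qed.

Lemma inr_inj (x y : C) : inr x = inr y :> nat + C -> x = y.
Proof. by case. Qed.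

Definition fin_part (g : Pow (nsum C)) : Pow natw := pull inl_inj g.
Definition inf_part (g : Pow (nsum C)) : Pow C := pull inr_inj g.

(** This is omega^(omega + C) = omega^omega * omega^C, with the infinite part most significant. *)
Lemma split_lt (g g' : Pow (nsum C)) : wo_lt g g' <->
  wo_lt (inf_part g) (inf_part g') \/ (inf_part g = inf_part g' /\ wo_lt (fin_part g) (fin_part g')).
Proof.
split=> [[[q|c] [gx hx]]|[[c [gx hx]]|[e [q [gx hx]]]]].
- right; split; first by apply: pow_eq => c; apply: (hx (inr c)).
  by exists q; split=> // r qr; apply: (hx (inl r)).
- by left; exists c; split=> // d cd; apply: (hx (inr d)).
- by exists (inr c); split=> // -[r|d] // cd; apply: hx.
- exists (inl q); split=> // -[r qr|d _]; first exact: hx.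
  exact: (congr1 (fun h : Pow C => h.@d) e).
Qed.

Lemma split_surj (h : Pow C) (d : Pow natw) :
  exists2 g : Pow (nsum C), inf_part g = h & fin_part g = d.
Proof.
pose p (x : nat + C) := match x with inl q => d.@q | inr c => h.@c end.
have supp : fin_supp p.
  have [[l hl] [l' hl']] := (proj2_sig d, proj2_sig h).
  exists (List.map inl l ++ List.map inr l') => -[q|c] /= hx; apply/List.in_or_app.
    by left; apply: List.in_map; apply: hl.
  by right; apply: List.in_map; apply: hl'.
by exists (exist _ p supp); apply: pow_eq.
Qed.
End SplitNsum.

(** * Reading indecomposability and infinite exponents off the normal form *)

Section Represented.
Variables (A C : woset) (f : Pow (nsum C)) (F : A -> Pow (nsum C)).
Hypothesis F_mono : forall x y, wo_lt x y -> wo_lt (F x) (F y).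
Hypothesis F_image : forall g, wo_lt g f <-> exists x, g = F x.

Lemma F_lt x y : wo_lt x y <-> wo_lt (F x) (F y).
Proof.
split=> [|h]; first exact: F_mono.
case: (wo_total x y) => [//|[e|/F_mono /(wo_asym h) //]].
by subst; case: (wo_irr h).
Qed.

Lemma F_le x y : wo_le x y <-> wo_le (F x) (F y).
Proof. by rewrite !wo_le_nlt F_lt. Qed.

Lemma F_below x : wo_lt (F x) f.
Proof. by apply/F_image; exists x. Qed.

Lemma rep_nonzero (a : A) : f <> pzero (nsum C).
Proof. by move=> e; have := F_below a; rewrite e => /lt_pzero. Qed.

Lemma om_indecomposable b : f = om b -> wo_lt (inl 0 : nsum C) b -> inf_indecomposable A.
Proof.
move=> fb b0; exists (seg b); split; first by exists; exists (inl 0).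
have Fb x : wo_lt (F x) (om b) by rewrite -fb; apply: F_below.
apply: (@order_iso_surj A _ _ (fun a => exp_sub b (F a))).
- exact: pow_irr.
- by move=> x y; rewrite F_lt; apply: exp_sub_lt.
- move=> h; have [g gb <-] := exp_sub_surj h; rewrite -fb in gb.
  by have [x ->] := proj1 (F_image g) gb; exists x.
Qed.

(* Past any point an indecomposable [A] contains a copy of itself, which would fit
   inside the last block of a longer normal form, hence below that point. *)
Lemma indecomposable_om : f <> pzero _ -> inf_indecomposable A -> exists b, f = om b.
Proof.
move=> f0 [B' [_ [ff [gg [ffK [ggK hff]]]]]].
have [b [f' [ef fb bmin hf']]] := peel_last f0.
exists b; case: (classic (f' = pzero _)) => [e|f'0]; first by rewrite ef e paddC padd0.
have f'f : wo_lt f' f by rewrite ef -{1}(padd0 f'); apply/padd_lt/pzero_lt_om.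
have [a ea] := proj1 (F_image f') f'f.
(* Translation by [a] in the given representation as omega^B'; it embeds [A] into its part from [a]
   on. *)
pose h x := gg (padd (ff a : Pow B') (ff x)).
have hm x y : wo_lt x y -> wo_lt (h x) (h y).
  move=> /hff xy; apply/hff; rewrite /h !ggK; exact/(@padd_lt B').
have ah x : wo_le f' (F (h x)).
  rewrite ea; apply/F_le; apply/wo_le_nlt => /hff; rewrite /h ggK.
  by move/(@wo_lt_nge (Pow B')); apply; apply: le_padd.
have omf' : wo_le (om b) f'.
  have [c fc] := pow_nonzero f'0; apply: wo_le_trans (supp_le_om fc).
  apply/om_le/wo_le_nlt => cb; exact: fc (hf' _ cb).
have lowf x : wo_lt (low b (F (h x)) : Pow _) f'.
  exact: wo_lt_le_trans (low_om b _) omf'.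
have /fun_choice [k hk] x : exists y, (low b (F (h x)) : Pow _) = F y.
  by apply/F_image; apply: wo_trans (lowf x) f'f.
have km x y : wo_lt x y -> wo_lt (k x) (k y).
  move=> /hm /F_mono xy; apply/F_lt; rewrite -!hk.
  by apply: (low_mono_block hf') => //; rewrite -?ef //; apply: F_below.
(* [k] would be a strictly monotone self-map of [A] sending [a] below itself. *)
have := wo_mono_infl km a; move/wo_le_nlt; case.
by apply/F_lt; rewrite -hk -ea.
Qed.

(** Without finite exponents in [f], comparison with [f] is decided by the infinite part alone and
    the finite part is free, so it ranges over all of omega^omega. *)
Lemma inf_supp_cnf : f <> pzero _ -> (forall x, f.@x <> 0 -> exists c, x = inr c) ->
  cnf_exponents_infinite A.
Proof.
move=> f0 hs; have fz : fin_part f = pzero natw.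
  by apply: pow_eq => q; apply: NNPP => /(hs (inl q)) [].
have ltf g : wo_lt g f <-> wo_lt (inf_part g) (inf_part f).
  rewrite split_lt fz; split=> [[//|[_ /lt_pzero //]]|]; by left.
exists (seg (inf_part f)); split.
  exists; exists (pzero C); apply: pzero_lt => e; apply: f0; apply: pow_eq => -[q|c].
    exact: (congr1 (fun h : Pow natw => h.@q) fz).
  exact: (congr1 (fun h : Pow C => h.@c) e).
have Fp a : wo_lt (inf_part (F a)) (inf_part f) by apply/ltf/F_below.
apply: (@order_iso_surj A _ _ (fun a => (exist (fun h => wo_lt h (inf_part f)) _ (Fp a), fin_part (F a)))).
- by move=> [h d] [/wo_irr|[_ /(@pow_irr natw)]].
- move=> x y; rewrite F_lt split_lt; split=> [[|[e]]|[|[e]]] /=; [by left| |by left|].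
    by right; split=> //; apply: sig_eq.
  by right; split=> //; apply: (congr1 (@proj1_sig _ _) e).
- move=> [[h hf] d]; have [g gh gd] := split_surj h d.
  have /F_image [a ea] : wo_lt g f by apply/ltf; rewrite gh.
  by exists a; congr pair; [apply: sig_eq; rewrite /= -ea | rewrite -ea].
Qed.

(* Past any point [A] contains a copy of omega^omega, which does not embed in a last
   block omega^q with [q] finite. *)
Lemma cnf_inf_supp : cnf_exponents_infinite A -> forall x, f.@x <> 0 -> exists c, x = inr c.
Proof.
move=> [G [_ [ff [gg [ffK [ggK hff]]]]]] [q|c] fq; last by exists c.
have f0 : f <> pzero _ by move=> e; rewrite e in fq.
have [b [f' [ef fb bmin hf']]] := peel_last f0.
have f'f : wo_lt f' f by rewrite ef -{1}(padd0 f'); apply/padd_lt/pzero_lt_om.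
have [a ea] := proj1 (F_image f') f'f.
have [p eb] : exists p : nat, b = inl p.
  by case: b bmin {ef fb hf'} => [p|c] bmin; [exists p | case: (bmin _ fq)].
pose h (d : Pow natw) := gg ((ff a).1, @padd natw (ff a).2 d).
have hm x y : wo_lt x y -> wo_lt (h x) (h y).
  by move=> xy; apply/hff; rewrite /h !ggK; right; split=> //; apply/(@padd_lt natw).
have ah x : wo_le f' (F (h x)).
  rewrite ea; apply/F_le; apply/wo_le_nlt => /hff; rewrite /h ggK => -[/wo_irr //|[_]].
  by move/(@wo_lt_nge (Pow natw)); apply; apply: le_padd.
pose k d : Pow natw := fin_part (low b (F (h d))).
have infz d : inf_part (low b (F (h d))) = pzero C.
  by apply: pow_eq => c; apply: (@low_ge (nsum C)); rewrite eb; left.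
have km x y : wo_lt x y -> wo_lt (k x) (k y).
  move=> /hm /F_mono xy.
  have : wo_lt (low b (F (h x)) : Pow _) (low b (F (h y))).
    by apply: (low_mono_block hf') => //; rewrite -?ef //; apply: F_below.
  by move/split_lt; rewrite !infz => -[/wo_irr|[]].
(* All values of [k] have their exponents below [p], so [k] sends omega^p strictly below itself. *)
have := wo_mono_infl km (om (p : natw)); move/wo_le_nlt; case.
apply/(@lt_om natw) => r hr; case: (wo_le_or_lt (p : natw) r) => // pr; case: hr.
apply: (@low_ge (nsum C)); rewrite eb; case: pr => [pr|->]; [by left | by right].
Qed.
End Represented.

(** * The product of the statement as a product of initial segments *)

Definition empty_woset : woset :=
  @WOSet Empty_set (fun _ _ => False) (fun x _ => match x with end)
    (fun x _ _ _ _ => match x with end) (fun x _ => match x with end) (fun x => match x with end).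

(** omega^0 * d is the integer d; this presents the finite chains as initial segments, like the
    infinite factors. *)
Lemma below_mono0 (C : woset) (g : Pow (nsum C)) d : wo_lt g (mono (inl 0 : nsum C) d) ->
  g.@(inl 0) < d /\ g = mono (inl 0 : nsum C) (g.@(inl 0)).
Proof.
move=> [x [gx hx]].
have e0 : x = inl 0 by apply: NNPP => hn; rewrite mono_out in gx.
subst x; rewrite mono_at in gx; split=> //; apply: pow_eq => y.
case: (classic (y = inl 0)) => [->|y0]; first by rewrite mono_at.
by rewrite mono_out // hx ?mono_out //; apply: nsum_gt0.
Qed.

Lemma mono0_lt (C : woset) c d :
  wo_lt (mono (inl 0 : nsum C) c) (mono (inl 0 : nsum C) d) <-> c < d.
Proof.
split=> [/below_mono0 []|cd]; first by rewrite mono_at.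
exists (inl 0); rewrite !mono_at; split=> // y y0.
by rewrite !mono_out // => e; subst y; apply: (@wo_irr (nsum C) (inl 0)).
Qed.

Lemma infinite_om (A C : woset) (f : Pow (nsum C)) (F : A -> Pow (nsum C)) b :
  (forall x y, wo_lt x y -> wo_lt (F x) (F y)) -> (forall g, wo_lt g f <-> exists x, g = F x) ->
  omega_le A -> f = om b -> wo_lt (inl 0 : nsum C) b.
Proof.
move=> Fm Fi [s hs] fb; apply: nsum_gt0 => b0; subst b.
have := F_below Fi (s 1); rewrite fb => /lt_om0 e.
by have := Fm _ _ (hs 0 1 isT); rewrite e => /lt_pzero.
Qed.

Section Transfer.
Variables (n m : nat) (A : 'I_n -> woset) (k : 'I_m -> nat).
Let I := ('I_n + 'I_m)%type : finType.

Definition tail (i : I) : woset := match i with inl i => with_top (A i) | inr _ => empty_woset end.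

Variables (fA : forall i, Pow (nsum (with_top (A i)))).
Variables (FA : forall i, A i -> Pow (nsum (with_top (A i)))).
Hypothesis FA_mono : forall i x y, wo_lt x y -> wo_lt (@FA i x) (@FA i y).
Hypothesis FA_image : forall i g, wo_lt g (fA i) <-> exists x, g = @FA i x.
Hypothesis A_inhab : forall i, inhabited (A i).
Hypothesis k_gt0 : forall j, 0 < k j.

Local Notation X := (ProdW (fun i : I => Pow (nsum (tail i)))).

Definition ends (i : I) : Pow (nsum (tail i)) :=
  match i return Pow (nsum (tail i)) with
  | inl i => fA i | inr j => mono (inl 0 : nsum empty_woset) (k j)
  end.

Definition code (x : Zcar A k) : X := fun i : I =>
  match i return Pow (nsum (tail i)) with
  | inl i => FA (x.1 i) | inr j => mono (inl 0 : nsum empty_woset) (x.2 j)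
  end.

Lemma code_le x y : Zle x y <-> prod_le (code x) (code y).
Proof.
split=> [[h1 h2] [i|j] /=|h].
- by apply/(F_le (@FA_mono i)).
- by apply/wo_le_nlt => /(@mono0_lt empty_woset); rewrite ltnNge h2.
- split=> [i|j]; first by apply/(F_le (@FA_mono i)); apply: (h (inl i)).
  by have /wo_le_nlt := h (inr j); rewrite leqNgt => hn; apply/negP => xy; apply: hn; apply/(@mono0_lt empty_woset).
Qed.

Lemma code_Z x : Z ends (code x).
Proof. by move=> [i|j] /=; [apply/FA_image; exists (x.1 i) | apply/(@mono0_lt empty_woset)/ltn_ord]. Qed.

Lemma code_surj y : Z ends y -> exists x, code x = y.
Proof.
move=> Zy.
have /fun_choice [a ha] i : exists a, y (inl i) = FA (i := i) a.
  by apply/FA_image; apply: (Zy (inl i)).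
have /fun_choice [c hc] j : exists c : 'I_(k j), y (inr j) = mono (inl 0 : nsum empty_woset) c.
  by have [lt e] := below_mono0 (Zy (inr j)); exists (Ordinal lt).
by exists (a, c); apply: functional_extensionality_dep => -[i|j] /=; rewrite ?ha ?hc.
Qed.

Lemma Zle_wf : well_founded (rstep (@Zle n m A k) false).
Proof.
move=> S; have acc := @wqo_wf X (fun _ => True).
have hle x y : @wqo_le X (code x) (code y) -> Zle x y by move/code_le.
exact: (@Acc_rstep_map _ X _ (@wqo_le X) false code _ acc hle S (fun x _ => Logic.I)).
Qed.

Definition Zw : wqo := Wqo Zle_wf.

Lemma rk_Zw v : rk v (fun _ : Zw => True) = rk v (Z ends).
Proof.
apply: leO_anti.
  apply: (@rk_map Zw X v _ _ code) => [x _|x y _ _ /code_le //]; exact: code_Z.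
have [x0] : inhabited (Zcar A k).
  have /fun_choice [a _] i : exists a : A i, True by case: (A_inhab i) => a; exists a.
  by exists; exact: (a, fun j => Ordinal (k_gt0 j)).
(* The inverse of [code] needs a value off its image; [x0] is an arbitrary default. *)
have /fun_choice [dec hdec] y : exists x, Z ends y -> code x = y.
  case: (classic (Z ends y)) => [/code_surj [x]|h]; first by exists x.
  by exists x0.
apply: (@rk_map X Zw v _ _ dec) => // x y Zx Zy /code_le.
by rewrite !hdec.
Qed.

Lemma ends_nonzero i : ends i <> pzero _.
Proof.
case: i => [i|j] /=.
  by have [a] := A_inhab i; apply: (@rep_nonzero _ _ _ (@FA i) (@FA_image i) a).
move=> e; have := congr1 (fun g : Pow (nsum empty_woset) => g.@(inl 0)) e.
by rewrite mono_at /= => k0; move: (k_gt0 j); rewrite k0.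
Qed.

End Transfer.

Theorem mainTheorem14 (n m : nat) (A : 'I_n -> woset) (k : 'I_m -> nat) :
  (0 < n)%N ->
  (forall i : 'I_n, omega_le (A i)) ->
  (forall j : 'I_m, (0 < k j)%N) ->
  (oeq (width (@Zle n m A k)) (mot (@Zle n m A k)) <->
   ((exists i : 'I_n, inf_indecomposable (A i)) /\
    (exists j1 j2 : 'I_n, j1 <> j2 /\
       cnf_exponents_infinite (A j1) /\ cnf_exponents_infinite (A j2)))).
Proof.
move=> n0 infA k0.
have /fun_choice [fA /fun_choice [FA hFA]] i := @embed_pow (A i).
have Fm i := proj1 (hFA i); have Fi i := proj2 (hFA i).
have inhA i : inhabited (A i) by have [s _] := infA i; exists; exact: s 0.
apply: iff_trans (width_eq_mot (Zw k Fm)) _; rewrite !(rk_Zw Fm Fi inhA k0).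
have f0 := ends_nonzero Fi inhA k0; set f := ends k fA in f0 *.
have /fun_choice [u hu] i : exists u : nat * (nat -> nsum (tail A i)) * (Pow (nsum (tail A i)) -> nat),
    Dec (f i) u.1.1 u.1.2 u.2 /\ (u.1.1 = 0 <-> exists b, f i = om b).
  by have [N [e [pos h]]] := dec_exists (f0 i); exists (N, e, pos).
pose N i := (u i).1.1; pose e i := (u i).1.2; pose pos i := (u i).2.
have D i : Dec (f i) (N i) (e i) (pos i) := proj1 (hu i).
have N0 i : N i = 0 <-> exists b, f i = om b := proj2 (hu i).
pose lo : block_index N := [ffun i => ord0].
pose hi : block_index N := [ffun i => ord_max].
have gt0 i b : f (inl i) = om b -> wo_lt (inl 0 : nsum _) b.
  exact: infinite_om (Fm i) (Fi i) (infA i).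
split=> [eq_rk|[[i0 hi0] [j1 [j2 [j12 [c1 c2]]]]]].
  have i_indec : exists i, inf_indecomposable (A i).
    apply: NNPP => hn.
    have Npos i : N (inl i) <> 0.
      move=> /N0 [b fb]; apply: hn; exists i.
      exact: (om_indecomposable (Fm i) (Fi i) fb (gt0 i b fb)).
    apply: (@ltO_irr (rk true (Z f))); rewrite {2}eq_rk.
    apply: (rk_anti_lt_bad_low_high D (lo := lo) (hi := hi)).
      apply/eqP => /ffunP /(_ (inl (Ordinal n0))); rewrite !ffunE => /(congr1 val) /= h.
      exact: Npos (esym h).
    (* A coordinate where [y] is below [x] has equal first and last position, hence a single block.
       As (i) fails, it is a finite factor with one point, where this is impossible. *)
    move=> x y [Zx px] [Zy py] i; apply/wo_le_nlt => yx.
    have := dec_mono (D i) (or_introl yx) (Zx i); rewrite px py !ffunE /= leqn0 => /eqP hN.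
    case: i hN yx {px py} => [i /Npos //|j] /N0 [b fb] yx.
    have b0 : b = inl 0.
      apply: NNPP => hb; have := congr1 (fun g : Pow (nsum empty_woset) => g.@b) fb.
      by rewrite mono_at (mono_out _ hb).
    subst b; have := Zx (inr j); rewrite fb => /lt_om0 ex; move: yx; rewrite ex.
    exact: lt_pzero.
  split=> //; have [i0 hi0] := i_indec; apply: NNPP => hn.
  (* [j0] is the one coordinate whose last exponent may be infinite; if there is none, any
     coordinate serves. *)
  have [j0 hj0] : exists j0, forall i, i != j0 -> ~ cnf_exponents_infinite (A i).
    case: (classic (exists j, cnf_exponents_infinite (A j))) => [[j cj]|hn'].
      by exists j => i ij ci; apply: hn; exists i, j; split=> //; apply/eqP.
    by exists i0 => i _ ci; apply: hn'; exists i.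
  apply: (@ltO_irr (rk true (Z f))); rewrite {2}eq_rk.
  apply: (rk_anti_lt_bad_block D (l := hi)).
  apply: (@rk_anti_lt_theta _ _ (inl j0)).
    move=> i ij; rewrite /block_exps ffunE /=.
    case E: (e i (N i)) => [q|c]; first by exists q.
    case: i ij c E => [i|j] ij c E; last by case: c E.
    (* The last exponent is the least one: were it infinite, all exponents would be. *)
    case: (hj0 i) => //; apply: (inf_supp_cnf (Fm i) (Fi i) (f0 (inl i))) => x fx.
    have := dec_min (D (inl i)) fx; rewrite E; case: x fx => [q|d] fx; last by exists d.
    by case.
  (* The indecomposable factor omega^b has [b] as its only exponent and b > 0, so the last block is
     more than a point. *)
  exists (inl i0); rewrite /block_exps ffunE /= => e0.
  have [b] := indecomposable_om (Fm i0) (Fi i0) (f0 (inl i0)) hi0; rewrite -[fA i0]/(f (inl i0)) => fb.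
  have := dec_supp (D (inl i0)) (leqnn _); rewrite e0 => fe.
  have := gt0 i0 b fb; have -> : b = inl 0.
    by apply: NNPP => hb; apply: fe; rewrite fb mono_out // => h; apply: hb.
  exact: wo_irr.
apply: (rk_anti_eq_bad_Z D).
  have [b] := indecomposable_om (Fm i0) (Fi i0) (f0 (inl i0)) hi0; rewrite -[fA i0]/(f (inl i0)) => fb.
  exists (inl i0), b, (inl 0); split=> //; first by apply/N0; exists b.
  exact: gt0.
move=> l.
(* Only [j1] and [j2] are shifted. Their exponents in the block are infinite, so the shift leaves
   the block unchanged, yet keeps both coordinates available for escape when exponents are
   lowered. *)
pose sp (i : 'I_n + 'I_m) := (i == inl j1) || (i == inl j2).
pose sh i : nsum (tail A i) -> nsum (tail A i) := if sp i then @one_plus (tail A i) else id.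
have inf_exp j : cnf_exponents_infinite (A j) -> exists c, block_exps e l (inl j) = inr c.
  move=> cj; apply: (cnf_inf_supp (Fm j) (Fi j) cj).
  by apply: (dec_supp (D (inl j))); rewrite -ltnS.
have sh_id : (fun i => sh i (block_exps e l i)) = block_exps e l.
  apply: functional_extensionality_dep => i; rewrite /sh /sp.
  case: eqP => [->|_]; first by have [c ->] := inf_exp _ c1.
  by case: eqP => [->|_] //; have [c ->] := inf_exp _ c2.
rewrite -{2}sh_id; apply: (@theta_le_shift _ _ sh (inl j1) (inl j2)).
- by apply/eqP => -[].
- by move=> i b b'; rewrite /sh; case: ifP => // _; apply: one_plus_mono.
- by move=> b; rewrite /sh /sp eqxx; apply: one_plus_gt0.
- by move=> b; rewrite /sh /sp eqxx orbT; apply: one_plus_gt0.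
Qed.
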